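(* There is an absolute constant $c$ such that for all integers $k,d,\chi \geq 2$, every $(\frac{1}{k},n^{0.9})$-pseudo-random graph $G$ on $n \geq k^{cd\log \chi}$ vertices has the following property: in every $2$-edge-coloring of $G$, every $d$-degenerate graph on $k$ vertices with chromatic number at most $\chi$ occurs as an induced monochromatic copy. Moreover, all of these induced monochromatic copies can be found in the same color (that is, for each $2$-edge-coloring of $G$ there is one of the two colors such that every $d$-degenerate graph on $k$ vertices with chromatic number at most $\chi$ occurs as an induced subgraph of $G$ all of whose edges have that color).
   Context: All graphs are finite and simple; $\log$ is to base $2$. For subsets $A,B$ of vertices of a graph, the edge density $d(A,B)$ is the fraction of pairs $(x,y)\in A\times B$ that are edges, $d(A,B)=\frac{e(A,B)}{|A||B|}$. A graph $G=(V,E)$ is $(p,\lambda)$-pseudo-random if $|d(A,B)-p| \leq \frac{\lambda}{\sqrt{|A||B|}}$ for all (nonempty) subsets $A,B \subset V$. A graph is $d$-degenerate if every subgraph of it has a vertex of degree at most $d$. An induced monochromatic copy of $H$ in an edge-colored graph $G$ is an induced subgraph of $G$ isomorphic to $H$ all of whose edges have the same color. *)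

(* Defs.v *)
From mathcomp Require Import all_boot all_order all_algebra.
From mathcomp Require Import reals exp.

Set Implicit Arguments.
Unset Strict Implicit.
Unset Printing Implicit Defensive.

Import Order.TTheory GRing.Theory Num.Theory.

Record sgraph := SGraph {
  vertex :> finType;
  edge : rel vertex;
  edge_sym : symmetric edge;
  edge_irrefl : irreflexive edge
}.

Section Induced.
Variables (G : sgraph) (S : {set G}).

Definition induced_edge : rel {x : G | x \in S} :=
  fun x y => edge (val x) (val y).

Fact induced_edge_sym : symmetric induced_edge.
Proof. by move=> x y; rewrite /induced_edge edge_sym. Qed.

Fact induced_edge_irrefl : irreflexive induced_edge.
Proof. by move=> x; rewrite /induced_edge edge_irrefl. Qed.

Definition induced : sgraph := SGraph induced_edge_sym induced_edge_irrefl.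

End Induced.

Definition isomorphic (G H : sgraph) : Prop :=
  exists f : G -> H, bijective f /\ {mono f : x y / edge x y}.

(* A subgraph is given by its vertex set S and its adjacency relation f; it
   need not be induced. *)
Definition is_subgraph (G : sgraph) (S : {set G}) (f : rel G) : Prop :=
  symmetric f /\ forall x y, f x y -> [/\ x \in S, y \in S & edge x y].

(* The empty subgraph has no vertex and is excluded. *)
Definition degenerate (d : nat) (G : sgraph) : Prop :=
  forall (S : {set G}) (f : rel G), is_subgraph S f -> S != set0 ->
    exists2 v, v \in S & #|[set w | f v w]| <= d.

Definition colorable (G : sgraph) (m : nat) : bool :=
  [exists c : {ffun G -> 'I_m}, [forall x, forall y, edge x y ==> (c x != c y)]].

Fact colorable_ex (G : sgraph) : exists m, colorable G m.
Proof.
exists #|G|; apply/existsP; exists [ffun x => enum_rank x].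
apply/forallP=> x; apply/forallP=> y; apply/implyP=> xy.
rewrite !ffunE (inj_eq enum_rank_inj).
by apply: contraTneq xy => ->; rewrite edge_irrefl.
Qed.

Definition chromatic_number (G : sgraph) : nat := ex_minn (colorable_ex G).

(* A 2-edge-coloring of G is a function c : {set G} -> bool whose value at
   [set x; y] is the color of the edge xy; its other values play no role. *)
Definition induced_mono_copy (H G : sgraph) (c : {set G} -> bool) (b : bool) :
    Prop :=
  exists S : {set G}, isomorphic H (induced S) /\
    {in S &, forall x y, edge x y -> c [set x; y] = b}.

Local Open Scope ring_scope.

Definition edge_density (R : realType) (G : sgraph) (A B : {set G}) : R :=
  #|[set xy in setX A B | edge xy.1 xy.2]|%:R / (#|A|%:R * #|B|%:R).

Definition pseudo_random (R : realType) (p lambda : R) (G : sgraph) : Prop :=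
  forall A B : {set G}, A != set0 -> B != set0 ->
    `|edge_density R A B - p| <= lambda / Num.sqrt (#|A|%:R * #|B|%:R).

Definition log2 (R : realType) (x : R) : R := ln x / ln 2.

(* Main.v *)
Require Import Defs.
From mathcomp Require Import all_boot all_order all_algebra.
From mathcomp Require Import reals exp.
From mathcomp Require Import ring lra zify.

Set Implicit Arguments.
Unset Strict Implicit.
Unset Printing Implicit Defensive.

Import Order.TTheory GRing.Theory Num.Theory.

Local Open Scope ring_scope.

(** Write n for the order of the host graph, p = 1/k for its density, and think
    of the two colours as red and blue.

    The bound n^0.9 on the discrepancy makes all edge counts between sets of
    size about n / K correct up to a relative error of 1/(4k), where
    K = k^(140 d h), h is the rounded-up logarithm of chi (or of k, if k is
    smaller) and n >= K^20 ([pseudo_random_jumbled]).  All the sets met below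
    are that large.

    The colour is chosen by a dichotomy which does not look at the graph to be
    embedded; this is why one colour serves all graphs ([color_dichotomy]).

    Either some large set U has red density at least k^-43 between any two
    subsets that are not smaller than k^-(49 d) |U|.  Then every d-degenerate
    graph on k vertices is embedded in red inside U, greedily along an order
    in which a vertex has at most d earlier neighbours ([dense_embedding]).
    The set of candidates for a vertex shrinks by a factor k^-43 for each of
    its at most d embedded neighbours, and by about 1 - 1/k for each embedded
    non-neighbour, by pseudo-randomness; hence it never leaves the range in
    which the density hypothesis applies.

    Or every large set contains two large subsets with red density below
    k^-43.  Iterating h times produces 2^h large sets with small pairwise
    red densities ([sparse_family]), enough to give one to each class of a
    proper colouring, and now the embedding is made in blue
    ([sparse_embedding]).  Red density k^-43 says nothing directly about the
    candidate sets, which shrink to a proportion k^-O(d).  The point is that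
    the red density between candidate sets does not grow on average: if w is
    a random vertex of a large set then, by pseudo-randomness, almost every
    red edge xy has both ends adjacent to w with probability close to p^2
    ([sum_edges_both_le]), while the number of pairs between the candidate
    sets is multiplied by about p^2 as well.  So w can be chosen such that the
    sum of the red densities, over the edges of H that remain to be embedded,
    is multiplied by at most 1 + O(1/k).  Over k steps this is a constant
    factor, so the red densities stay below a small power of 1/k, and most
    candidates for a vertex have almost all their edges to the candidate sets
    of its neighbours in blue. *)

(** * Degrees and edge counts *)

Section Counting.
Variables (R : realFieldType) (T : finType).
Implicit Types (g r : rel T) (A B C : {set T}).

Definition deg r (x : T) B : R := #|[set y in B | r x y]|%:R.

Definition edges r A B : R := \sum_(x in A) deg r x B.

Lemma degE r x B : deg r x B = \sum_(y in B) (r x y)%:R.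
Proof.
rewrite /deg -sum1_card natr_sum (eq_bigl (fun y => (y \in B) && r x y)).
  by rewrite big_mkcondr; apply: eq_bigr => y _; case: (r x y).
by move=> y; rewrite inE.
Qed.

Lemma deg_ge0 r x B : 0 <= deg r x B. Proof. exact: ler0n. Qed.

Lemma edges_ge0 r A B : 0 <= edges r A B.
Proof. by apply: sumr_ge0 => x _; exact: deg_ge0. Qed.

Lemma deg_sub r x B B' : B \subset B' -> deg r x B <= deg r x B'.
Proof.
move=> BB'; rewrite ler_nat; apply/subset_leq_card/subsetP => y.
by rewrite !inE => /andP[/(subsetP BB')-> ->].
Qed.

Lemma deg_le_card r x B : deg r x B <= #|B|%:R.
Proof. by rewrite ler_nat; apply/subset_leq_card/subsetP => y /setIdP[]. Qed.

Lemma deg_split g r x B : subrel r g ->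
  deg (fun u v => g u v && ~~ r u v) x B = deg g x B - deg r x B.
Proof.
move=> rg; rewrite !degE -sumrB; apply: eq_bigr => y _.
have := rg x y; case: (r x y) => [->//|_]; first by rewrite subrr.
by rewrite andbT subr0.
Qed.

Lemma sum_subset (F : T -> R) A A' : (forall x, 0 <= F x) -> A \subset A' ->
  \sum_(x in A) F x <= \sum_(x in A') F x.
Proof.
move=> F0 AA'; rewrite [leRHS](big_setID A) /= (setIidPr AA') lerDl.
by apply: sumr_ge0.
Qed.

Lemma edges_sub r A A' B B' : A \subset A' -> B \subset B' ->
  edges r A B <= edges r A' B'.
Proof.
move=> AA' BB'; apply: (@le_trans _ _ (edges r A B')).
  by apply: ler_sum => x _; exact: deg_sub.
by apply: sum_subset => // x; exact: deg_ge0.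
Qed.

Lemma edges_sym r A B : symmetric r -> edges r A B = edges r B A.
Proof.
move=> rs; rewrite /edges; under eq_bigr do rewrite degE.
rewrite exchange_big /=; apply: eq_bigr => y _.
by rewrite degE; apply: eq_bigr => x _; rewrite rs.
Qed.

Lemma edges_le_deg r A B (t : R) : (forall x, x \in A -> deg r x B <= t) ->
  edges r A B <= t * #|A|%:R.
Proof. by move=> h; rewrite mulr_natr -sumr_const; exact: ler_sum. Qed.

Lemma edges_ge_deg r A B (t : R) : (forall x, x \in A -> t <= deg r x B) ->
  t * #|A|%:R <= edges r A B.
Proof. by move=> h; rewrite mulr_natr -sumr_const; exact: ler_sum. Qed.

(** Markov's inequality. *)
Lemma few_high_deg r A B (t : R) : 
  t * #|[set x in A | t < deg r x B]|%:R <= edges r A B.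
Proof.
apply: (@le_trans _ _ (edges r [set x in A | t < deg r x B] B)).
  by apply: edges_ge_deg => x; rewrite inE => /andP[_ /ltW].
by apply: edges_sub => //; apply/subsetP => x; rewrite inE => /andP[].
Qed.

(** The vertices of low degree form a set which is itself too sparse to be
    large. *)
Lemma few_low_deg r A B (t a : R) : 0 < a ->
  (forall A', A' \subset A -> a <= #|A'|%:R -> t * #|A'|%:R <= edges r A' B) ->
  #|[set x in A | deg r x B < t]|%:R < a.
Proof.
move=> a0 dense; rewrite ltNge; apply/negP => big.
have sub : [set x in A | deg r x B < t] \subset A.
  by apply/subsetP => x; rewrite inE => /andP[].
have := dense _ sub big; rewrite leNgt => /negP; apply.
rewrite mulr_natr -sumr_const; apply: ltr_sum => [|x]; last first.
  by rewrite inE => /andP[].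
apply/hasP; have /card_gt0P[x xA] : (0 < #|[set x in A | (deg r x B < t)%R]|)%N.
  by rewrite -(ltr_nat R); apply: lt_le_trans big.
by exists x; rewrite // mem_index_enum.
Qed.

Lemma sum_edges_one g r A B C : symmetric g ->
  \sum_(w in A) edges r [set x in B | g w x] C =
  \sum_(x in B) deg g x A * deg r x C.
Proof.
move=> gs; transitivity (\sum_(w in A) \sum_(x in B) (g w x)%:R * deg r x C).
  apply: eq_bigr => w _; rewrite /edges.
  rewrite (eq_bigl (fun x => (x \in B) && g w x)) => [|x]; last by rewrite inE.
  by rewrite big_mkcondr; apply: eq_bigr => x _; case: (g w x);
     rewrite ?mul1r ?mul0r.
rewrite exchange_big /=. apply: eq_bigr => x _. rewrite -mulr_suml (degE g).
by congr (_ * _); apply: eq_bigr => w _; rewrite gs.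
Qed.

(** Both sides count the triples [(w, x, y)] such that [w] is g-adjacent to [x]
    and [y], and [x] is r-adjacent to [y].  On the right the count is again
    one of g-edges between two sets, to which pseudo-randomness applies. *)
Lemma sum_edges_both g r A B C : symmetric g ->
  \sum_(w in A) edges r [set x in B | g w x] [set y in C | g w y] =
  \sum_(x in B) edges g [set w in A | g x w] [set y in C | r x y].
Proof.
move=> gs.
transitivity (\sum_(w in A) \sum_(x in B)
    (g w x)%:R * deg r x [set y in C | g w y]).
  apply: eq_bigr => w _; rewrite /edges.
  rewrite (eq_bigl (fun x => (x \in B) && g w x)) => [|x]; last by rewrite inE.
  by rewrite big_mkcondr; apply: eq_bigr => x _; case: (g w x);
     rewrite ?mul1r ?mul0r.
rewrite exchange_big /=; apply: eq_bigr => x _.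
rewrite /edges [RHS](eq_bigl (fun w => (w \in A) && g x w)) => [|w]; last first.
  by rewrite inE.
rewrite big_mkcondr; apply: eq_bigr => w _; rewrite gs.
case: (g x w); rewrite ?mul1r ?mul0r //; congr (_%:R); apply: eq_card => y.
by rewrite !inE -!andbA; congr andb; rewrite andbC.
Qed.

Lemma card_avoid (I : finType) A (Bad : I -> {set T}) (t : R) :
  (forall i, #|Bad i|%:R <= t) ->
  #|A|%:R - #|I|%:R * t <= #|A :\: \bigcup_i Bad i|%:R.
Proof.
move=> Badt.
rewrite lerBlDr -(cardsID (\bigcup_i Bad i) A) natrD addrC lerD2l.
apply: (@le_trans _ _ (\sum_(i : I) #|Bad i|%:R)); last first.
  rewrite mulr_natl -sumr_const.
  by apply: ler_sum => i _; exact: Badt.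
rewrite -natr_sum ler_nat.
apply: leq_trans (subset_leq_card (subsetIr _ _)) _.
apply: (big_ind2 (fun (X : {set T}) n => #|X| <= n)%N); rewrite ?cards0 //.
move=> X a Y b Xa Yb; apply: leq_trans (leq_add Xa Yb).
by rewrite cardsU leq_subr.
Qed.

Lemma exists_le_avg A (F : T -> R) (t : R) :
  A != set0 -> \sum_(w in A) F w <= t * #|A|%:R ->
  exists2 w, w \in A & F w <= t.
Proof.
case/set0Pn => w0 w0A le; apply/exists_inP; apply: contraLR le.
rewrite negb_exists_in -ltNge mulr_natr -sumr_const => /forall_inP lt.
apply: ltr_sum => [|w /lt]; last by rewrite -ltNge.
by apply/hasP; exists w0 => //; exact: mem_index_enum.
Qed.

End Counting.

(** * Monochromatic copies and greedy embeddings *)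

Definition color_rel (G : sgraph) (col : {set G} -> bool) (b : bool) : rel G :=
  fun x y => edge x y && (col [set x; y] == b).

Lemma color_rel_sym G col b : symmetric (@color_rel G col b).
Proof. by move=> x y; rewrite /color_rel edge_sym setUC. Qed.

Lemma color_rel_sub G col b : subrel (@color_rel G col b) (@edge G).
Proof. by move=> x y /andP[]. Qed.

Definition embedded_pair (H G : sgraph) (r : rel G) (phi : H -> G) (u v : H) :=
  if edge u v then r (phi u) (phi v)
  else (phi u != phi v) && ~~ edge (phi u) (phi v).

Lemma mono_copy_of_embedding (H G : sgraph) col b (phi : H -> G) :
  (forall u v, u != v -> embedded_pair (color_rel col b) phi u v) ->
  induced_mono_copy H col b.
Proof.
move=> emb.
have phi_inj : injective phi.
  move=> u v eq_uv; apply/eqP; apply: contraT => /emb.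
  rewrite /embedded_pair eq_uv eqxx /color_rel edge_irrefl /=.
  by case: ifP.
have phi_mono u v : edge (phi u) (phi v) = edge u v.
  case: (eqVneq u v) => [->|/emb]; first by rewrite !edge_irrefl.
  rewrite /embedded_pair; case: ifP => _; first by case/andP.
  by case/andP => _ /negbTE.
exists [set phi u | u : H]; split; last first.
  move=> _ _ /imsetP[u _ ->] /imsetP[v _ ->] uv.
  have /emb : u != v by apply: contraTneq uv => ->; rewrite edge_irrefl.
  by rewrite /embedded_pair -phi_mono uv => /andP[_ /eqP].
have phiS u : phi u \in [set phi u | u : H] by apply: imset_f.
exists (fun u => exist _ (phi u) (phiS u)); split; last exact: phi_mono.
have inv x : x \in [set phi u | u : H] -> {u | phi u == x}.
  move=> xS; apply: sigW; case/imsetP: xS => u _ ->; by exists u.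
exists (fun y => val (inv (val y) (valP y))) => [u|y].
  by case: (inv _ _) => v /= /eqP /phi_inj.
by apply: val_inj => /=; case: (inv _ _) => v /= /eqP.
Qed.

Section Greedy.
Variables (H G : sgraph) (r : rel G).
Hypothesis r_sym : symmetric r.

Definition shrink (i : H) (w : G) (C : H -> {set G}) (j : H) : {set G} :=
  if edge i j then [set x in C j | r w x]
  else [set x in C j | (w != x) && ~~ edge w x].

Lemma shrink_pair (phi : H -> G) i w C j :
  phi i = w -> phi j \in shrink i w C j ->
  embedded_pair r phi i j && embedded_pair r phi j i.
Proof.
move=> <-; rewrite /shrink /embedded_pair edge_sym; case: ifP => _;
  rewrite inE => /andP[_].
  by rewrite (r_sym (phi j)) => ->.
by rewrite (eq_sym (phi j)) (edge_sym (phi j)) => ->.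
Qed.

(** The choices made for earlier vertices are recorded only in the candidate
    sets, so an invariant [Inv] on these, depending on the prefix of [s]
    already embedded, suffices.  A neighbour chosen in [shrink i w C j] is
    r-adjacent to [w], and a non-neighbour is distinct from [w] and
    non-adjacent to it: the copy is injective and induced. *)
Lemma greedy_embedding (s : seq H) (Inv : seq H -> (H -> {set G}) -> Prop) C0
    (x0 : G) :
  uniq s -> (forall u, u \in s) -> Inv [::] C0 ->
  (forall s1 i s2 C, s = s1 ++ i :: s2 -> Inv s1 C ->
     exists2 w, w \in C i & Inv (rcons s1 i) (shrink i w C)) ->
  exists phi : H -> G, forall u v, u != v -> embedded_pair r phi u v.
Proof.
move=> s_uniq s_all Inv0 step.
suff: forall s2 s1 C, s = s1 ++ s2 -> Inv s1 C -> exists phi : H -> G,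
    {in s2, forall j, phi j \in C j} /\
    {in s2 &, forall u v, u != v -> embedded_pair r phi u v}.
  move=> /(_ s [::] C0 erefl Inv0)[phi [_ emb]].
  by exists phi => u v uv; apply: emb.
elim=> [|i s2 IH] s1 C def_s InvC; first by exists (fun=> x0).
have [w wC InvC'] := step _ _ _ _ def_s InvC.
have [|phi [phiC emb]] := IH (rcons s1 i) _ _ InvC'.
  by rewrite cat_rcons.
have i_s2 : i \notin s2.
  by move: s_uniq; rewrite def_s cat_uniq /= => /and3P[_ _ /andP[]].
pose phi' u := if u == i then w else phi u.
have phi'E u : u \in s2 -> phi' u = phi u.
  by rewrite /phi'; case: eqP => // -> /(negP i_s2).
have phi'i : phi' i = w by rewrite /phi' eqxx.
have shr j : j \in s2 -> phi' j \in shrink i w C j.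
  by move=> js2; rewrite phi'E //; exact: phiC.
exists phi'; split=> [j|u v]; rewrite inE.
  case/predU1P=> [->|js2]; first by rewrite phi'i.
  by have := shr _ js2; rewrite /shrink; case: ifP; rewrite inE => _ /andP[].
case/predU1P => [->|us2]; rewrite inE => /predU1P[->|vs2] uv.
- by rewrite eqxx in uv.
- by have /andP[] := shrink_pair phi'i (shr _ vs2).
- by have /andP[] := shrink_pair phi'i (shr _ us2).
- by rewrite /embedded_pair !phi'E //; exact: emb.
Qed.

End Greedy.

(** Vertices of degree at most [d] in what is left are removed one by one; the
    order is the reverse of the order of removal.  The bound is stated for
    every prefix before [j], not just for the full set of its predecessors,
    since it is needed at each step before [j] is embedded. *)
Lemma degenerate_order d (H : sgraph) : degenerate d H ->
  exists s : seq H, [/\ uniq s, forall u, u \in s &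
    forall s1 s2 j, s = s1 ++ s2 -> j \in s2 -> (count (edge j) s1 <= d)%N].
Proof.
move=> deg_H.
suff: forall n (S : {set H}), #|S| = n ->
    exists s : seq H, [/\ uniq s, s =i S & forall s1 s2 j, s = s1 ++ s2 ->
      j \in s2 -> (count (edge j) s1 <= d)%N].
  move=> /(_ _ setT erefl)[s [us sT ord]]; exists s; split=> // u.
  by rewrite sT inE.
elim=> [|n IH] S cardS.
  exists [::]; split=> // [u|[|? ?] [|? ?] //].
  by rewrite (cards0_eq cardS) inE.
have S0 : S != set0 by rewrite -card_gt0 cardS.
pose f : rel H := fun x y => [&& x \in S, y \in S & edge x y].
have [|v vS dv] := deg_H S f _ S0.
  split=> [x y|x y /and3P[]//]; rewrite /f edge_sym.
  by case: (x \in S); case: (y \in S).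
have [|s [us sS ord]] := IH (S :\ v).
  by move: cardS; rewrite (cardsD1 v) vS => -[].
have vs : v \notin s by rewrite sS !inE eqxx.
exists (rcons s v); split.
- by rewrite rcons_uniq vs.
- move=> u; rewrite mem_rcons inE sS !inE.
  by case: eqP => [->|].
move=> s1 s2 j; case: (lastP s2) => [//|s2' v'].
rewrite -rcons_cat => /rcons_inj[def_s <-].
rewrite mem_rcons inE => /predU1P[->|js2]; last exact: ord js2.
apply: leq_trans dv.
apply: (@leq_trans (count (edge v) s)).
  by rewrite def_s count_cat leq_addr.
rewrite -size_filter -(card_uniqP _); last exact: filter_uniq.
apply/subset_leq_card/subsetP => u; rewrite mem_filter inE sS !inE /f.
by case/and3P => -> _ ->; rewrite vS.
Qed.

Lemma colorable_chromatic (H : sgraph) : colorable H (chromatic_number H).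
Proof. by rewrite /chromatic_number; case: ex_minnP. Qed.

Lemma chromatic_le_card (H : sgraph) : (chromatic_number H <= #|H|)%N.
Proof.
rewrite /chromatic_number; case: ex_minnP => m _; apply.
apply/existsP; exists [ffun x => enum_rank x].
apply/forallP=> x; apply/forallP=> y; apply/implyP=> xy.
rewrite !ffunE (inj_eq enum_rank_inj).
by apply: contraTneq xy => ->; rewrite edge_irrefl.
Qed.

Lemma chromatic_coloring (H : sgraph) q : (chromatic_number H <= q)%N ->
  exists f : H -> nat, (forall u, (f u < q)%N) /\
    forall u v, edge u v -> f u != f v.
Proof.
have /existsP[c /forallP col] := colorable_chromatic H.
move=> le_q; exists (fun u => c u : nat); split=> [u|u v uv].
  exact: leq_trans (ltn_ord _) le_q.
by have /forallP/(_ v)/implyP/(_ uv) := col u.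
Qed.

(** * Pseudo-random graphs *)

Section Jumbled.
Variables (R : realFieldType) (T : finType).
Implicit Types (g r : rel T) (A B C : {set T}).

(** The form in which pseudo-randomness is used: a uniform error on the
    density between all sets with at least [m] elements. *)
Definition jumbled g (p eta : R) (m : nat) := forall A B,
  (m <= #|A|)%N -> (m <= #|B|)%N ->
  (p - eta) * (#|A|%:R * #|B|%:R) <= edges R g A B
    <= (p + eta) * (#|A|%:R * #|B|%:R).

Variables (g : rel T) (p eta : R) (m : nat).
Hypotheses (g_sym : symmetric g) (jum : jumbled g p eta m).
Hypotheses (m_gt0 : (0 < m)%N) (mT : (m <= #|T|)%N) (q_ge0 : 0 <= p + eta).

(** Enlarging both sets by the same [m] vertices gives an upper bound without
    any lower bound on the sizes. *)
Lemma jumbled_upper A B :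
  edges R g A B <= (p + eta) * ((#|A|%:R + m%:R) * (#|B|%:R + m%:R)).
Proof.
pose S := [set x in take m (enum T)].
have cardS : #|S| = m.
  rewrite cardsE (card_uniqP _) ?take_uniq ?enum_uniq //.
  by rewrite size_take_min -cardE; apply/minn_idPl.
have ge X : (m <= #|X :|: S|)%N by rewrite -cardS subset_leq_card // subsetUr.
have le X : #|X :|: S|%:R <= #|X|%:R + m%:R :> R.
  by rewrite -natrD ler_nat -cardS cardsU leq_subr.
apply: le_trans (@edges_sub _ _ g A (A :|: S) B (B :|: S) _ _) _;
  rewrite ?subsetUl //.
have /andP[_ up] := jum (ge A) (ge B).
by apply: le_trans up _; rewrite ler_wpM2l // ler_pM ?ler0n.
Qed.

(** As many as [m] exceptional vertices would form, with [B], a pair with too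
    few edges. *)
Lemma jumbled_few_low A B : (m <= #|B|)%N ->
  #|[set x in A | deg R g x B < (p - eta) * #|B|%:R]|%:R <= m%:R :> R.
Proof.
move=> mB; apply/ltW/few_low_deg; first by rewrite ltr0n.
move=> A' _; rewrite ler_nat => mA'; have /andP[lo _] := jum mA' mB.
by rewrite -mulrA [#|B|%:R * _]mulrC.
Qed.

Lemma jumbled_few_high A B : (m <= #|B|)%N ->
  #|[set x in A | (p + eta) * #|B|%:R < deg R g x B]|%:R <= m%:R :> R.
Proof.
move=> mB; set X := [set x in A | _]; rewrite ler_nat leqNgt; apply/negP => mX.
have /andP[_ up] := jum (ltnW mX) mB.
suff: (p + eta) * #|B|%:R * #|X|%:R < edges R g X B.
  by rewrite -mulrA [#|B|%:R * _]mulrC ltNge up.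
rewrite mulr_natr -sumr_const; apply: ltr_sum => [|x]; last first.
  by rewrite inE => /andP[].
apply/hasP; have /card_gt0P[x xX] : (0 < #|X|)%N by exact: leq_ltn_trans mX.
by exists x; rewrite // mem_index_enum.
Qed.

Variable q : R.

(** All but [m] of the degrees into [A] are at most [(p + eta) * #|A|]; for the
    others, the trivial bounds on the degree and on [F] are used. *)
Lemma sum_deg_bound A B (F : T -> R) (M : R) :
  (m <= #|A|)%N -> (p + eta) * #|A|%:R + m%:R <= q * #|A|%:R ->
  0 <= M -> (forall x, 0 <= F x <= M) ->
  \sum_(x in B) (deg R g x A + m%:R) * F x
    <= #|A|%:R * (q * \sum_(x in B) F x + 2 * m%:R * M).
Proof.
move=> mA qA M0 FM; pose X := [set x in B | (p + eta) * #|A|%:R < deg R g x A].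
have cX : #|X|%:R <= m%:R :> R by exact: jumbled_few_high.
have qA0 : 0 <= q * #|A|%:R.
  by apply: le_trans qA; rewrite addr_ge0 ?mulr_ge0 ?ler0n.
apply: (@le_trans _ _ (\sum_(x in B) (q * #|A|%:R) * F x
                       + \sum_(x in X) (2 * #|A|%:R) * M)).
  have -> : \sum_(x in X) (2 * #|A|%:R) * M =
      \sum_(x in B) (if x \in X then (2 * #|A|%:R) * M else 0).
    rewrite -big_mkcondr; apply: eq_bigl => x /=.
    by rewrite inE; case: (x \in B).
  rewrite -big_split; apply: ler_sum => x xB /=.
  have dA := deg_le_card R g x A.
  have mA' : m%:R <= #|A|%:R :> R by rewrite ler_nat.
  case/andP: (FM x) => F0 FxM.
  case: ifPn => xX.
    rewrite -[leLHS]add0r lerD //; first exact: mulr_ge0.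
    rewrite ler_pM ?addr_ge0 ?ler0n ?deg_ge0 //.
    lra.
  rewrite addr0 ler_wpM2r //; apply: le_trans qA; rewrite lerD2r.
  by move: xX; rewrite inE xB -leNgt.
rewrite -mulr_sumr sumr_const -[_ *+ #|X|]mulr_natr.
rewrite mulrDr !mulrA [#|A|%:R * q]mulrC lerD2l.
have: 2 * #|A|%:R * M * #|X|%:R <= 2 * #|A|%:R * M * m%:R.
  by rewrite ler_wpM2l // !mulr_ge0 ?ler0n.
lra.
Qed.

Let card_le_T A : #|A|%:R <= #|T|%:R :> R.
Proof. by rewrite ler_nat max_card. Qed.

(** In expectation over [w], restricting one side of the pair [(B, C)] to the
    neighbours of [w] multiplies the number of r-edges by about [q], which is
    slightly larger than [p].  The additive error is small compared with the
    product of the sizes of two large sets. *)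
Lemma sum_edges_one_le r A B C :
  (m <= #|A|)%N -> (p + eta) * #|A|%:R + m%:R <= q * #|A|%:R ->
  p <= q -> q <= 1 -> 0 < p ->
  \sum_(w in A) edges R r [set x in B | g w x] C
    <= #|A|%:R * (q * (edges R r B C + 5 * m%:R * #|T|%:R / p ^+ 2)).
Proof.
move=> mA qA pq q1 p0; rewrite sum_edges_one //.
have n0 : 0 <= #|T|%:R :> R by rewrite ler0n.
have m0 : 0 <= m%:R :> R by rewrite ler0n.
have deg_n x : 0 <= deg R r x C <= #|T|%:R.
  by rewrite deg_ge0 (le_trans (deg_le_card _ _ _ _)).
have := sum_deg_bound (F := fun x => deg R r x C) B mA qA n0 deg_n.
rewrite -/(edges R r B C) => le.
have le1 : \sum_(x in B) deg R g x A * deg R r x C <=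
    \sum_(x in B) (deg R g x A + m%:R) * deg R r x C.
  by apply: ler_sum => x _; rewrite ler_wpM2r ?deg_ge0 // lerDl.
apply: le_trans le1 (le_trans le _).
rewrite ler_wpM2l ?ler0n // mulrDr lerD2l.
have -> : q * (5 * m%:R * #|T|%:R / p ^+ 2) = 5 * m%:R * #|T|%:R * (q / p ^+ 2).
  by ring.
have le_qp : 1 <= q / p ^+ 2.
  rewrite ler_pdivlMr ?exprn_gt0 // mul1r; apply: le_trans (pq).
  by rewrite expr2 ler_piMl ?(ltW p0) // (le_trans pq).
have mn : 0 <= 5 * m%:R * #|T|%:R :> R by rewrite !mulr_ge0.
have : 5 * m%:R * #|T|%:R <= 5 * m%:R * #|T|%:R * (q / p ^+ 2).
  by rewrite ler_peMr.
lra.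
Qed.

(** The same with both sides restricted.  For fixed [x] the number of pairs
    [(w, y)] is a number of edges between a neighbourhood in [A] and an
    r-neighbourhood in [C]; the latter may be small, which is why
    [jumbled_upper] has no condition on the sizes. *)
Lemma sum_edges_both_le r A B C :
  (m <= #|A|)%N -> (p + eta) * #|A|%:R + m%:R <= q * #|A|%:R ->
  p + eta <= q -> p <= q -> q <= 1 -> 0 < p ->
  \sum_(w in A) edges R r [set x in B | g w x] [set y in C | g w y]
    <= #|A|%:R * (q ^+ 2 * (edges R r B C + 5 * m%:R * #|T|%:R / p ^+ 2)).
Proof.
move=> mA qA peq pq q1 p0; rewrite sum_edges_both //.
have n0 : 0 <= #|T|%:R :> R by rewrite ler0n.
have m0 : 0 <= m%:R :> R by rewrite ler0n.
have mn : m%:R <= #|T|%:R :> R by rewrite ler_nat.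
have deg_n x : 0 <= deg R r x C + m%:R <= 2 * #|T|%:R.
  rewrite addr_ge0 ?deg_ge0 //=.
  have : deg R r x C <= #|T|%:R := le_trans (deg_le_card R r x C) (card_le_T C).
  lra.
have n20 : 0 <= 2 * #|T|%:R :> R by rewrite mulr_ge0.
have := sum_deg_bound (F := fun x => deg R r x C + m%:R) B mA qA n20 deg_n.
rewrite big_split /= -/(edges R r B C) sumr_const -(mulr_natr m%:R #|B|) => le.
have le1 : \sum_(x in B) edges R g [set w in A | g x w] [set y in C | r x y] <=
    (p + eta) * \sum_(x in B) (deg R g x A + m%:R) * (deg R r x C + m%:R).
  by rewrite mulr_sumr; apply: ler_sum => x _; exact: jumbled_upper.
apply: le_trans le1 _.
apply: le_trans (ler_wpM2l q_ge0 le) _.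
set a := #|A|%:R; set N := #|T|%:R; set e := edges _ _ _ _; set M := m%:R.
have a0 : 0 <= a by rewrite ler0n.
have e0 : 0 <= e by exact: edges_ge0.
have bN : #|B|%:R <= N by exact: card_le_T.
have q0 : 0 <= q by exact: le_trans peq.
rewrite mulrCA ler_wpM2l //.
have MN0 : 0 <= M * N by rewrite mulr_ge0.
have inv : p ^+ 2 / p ^+ 2 = 1 by rewrite divff // expf_neq0 ?gt_eqF.
have q2p : p ^+ 2 <= q ^+ 2 by rewrite ler_pXn2r // nnegrE ltW.
have le_qp : 1 <= q ^+ 2 / p ^+ 2.
  by rewrite ler_pdivlMr ?exprn_gt0 // mul1r.
apply: (@le_trans _ _ (q * (q * (e + M * N) + 4 * (M * N)))).
  apply: ler_pM => //.
    by rewrite addr_ge0 ?mulr_ge0 ?addr_ge0 ?mulr_ge0 ?ler0n.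
  have -> : 2 * M * (2 * N) = 4 * (M * N) by ring.
  by rewrite lerD2r ler_wpM2l // lerD2l ler_wpM2l.
have -> : q ^+ 2 * (e + 5 * M * N / p ^+ 2) =
  q ^+ 2 * e + 5 * (M * N) * (q ^+ 2 / p ^+ 2) by ring.
have : 5 * (M * N) <= 5 * (M * N) * (q ^+ 2 / p ^+ 2).
  by rewrite ler_peMr // mulr_ge0.
have : q * (q * (M * N)) <= 1 * (1 * (M * N)).
  by rewrite !ler_pM // mulr_ge0.
have : q * (M * N) <= 1 * (M * N) by rewrite ler_wpM2r.
rewrite expr2; lra.
Qed.

End Jumbled.

(** * Families of pairwise sparse sets *)

Section SparseFamily.
Variables (R : realFieldType) (T : finType) (r : rel T).
Hypothesis r_sym : symmetric r.
Variables (delta rho s : R).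
Hypotheses (delta_gt0 : 0 < delta) (delta_le1 : delta <= 1).
Hypotheses (rho_gt0 : 0 < rho) (s_gt0 : 0 < s).
Hypothesis sparse_pair : forall U : {set T}, s <= #|U|%:R ->
  exists A B : {set T}, [/\ A \subset U, B \subset U,
    delta * #|U|%:R <= #|A|%:R, delta * #|U|%:R <= #|B|%:R &
    edges R r A B <= rho * (#|A|%:R * #|B|%:R)].

Lemma low_degree_part (A B : {set T}) (t : R) : 0 < t * #|B|%:R ->
  edges R r A B <= t * (#|A|%:R * #|B|%:R) ->
  #|A|%:R / 2 <= #|[set x in A | deg R r x B <= 2 * t * #|B|%:R]|%:R :> R.
Proof.
move=> tB le; have mk := few_high_deg r A B (2 * t * #|B|%:R).
have := cardsID [set x | deg R r x B <= 2 * t * #|B|%:R] A.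
move/(congr1 (fun n => n%:R : R)); rewrite natrD => <-.
have -> : A :&: [set x | deg R r x B <= 2 * t * #|B|%:R] =
   [set x in A | deg R r x B <= 2 * t * #|B|%:R].
  by apply/setP => x; rewrite !inE.
have -> : A :\: [set x | deg R r x B <= 2 * t * #|B|%:R] =
   [set x in A | 2 * t * #|B|%:R < deg R r x B].
  by apply/setP => x; rewrite !inE ltNge andbC.
set X := #|_|%:R; set Y := #|_|%:R.
have : 2 * t * #|B|%:R * Y <= t * (#|A|%:R * #|B|%:R) := le_trans mk le.
have -> : 2 * t * #|B|%:R * Y = t * #|B|%:R * (2 * Y) by ring.
have -> : t * (#|A|%:R * #|B|%:R) = t * #|B|%:R * #|A|%:R by ring.
rewrite ler_pM2l //.
have -> : #|A|%:R = X + Y.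
  rewrite /X /Y -natrD -(cardsID [set x | deg R r x B <= 2 * t * #|B|%:R] A).
  congr ((_ + _)%:R); apply: eq_card => x; rewrite !inE //.
  by rewrite ltNge andbC.
lra.
Qed.

(** In a sparse pair [(A, B)] the set [A] is first reduced to vertices of low
    degree into [B].  The family obtained inside [A] then has few edges to [B],
    so that half of [B] consists of vertices of low degree into every member,
    and the second family is built there.  As the degrees from the second
    family into the first are controlled vertex by vertex, passing to small
    subsets loses nothing; the factor [2 ^+ h] comes from the union bound over
    the members of the first family. *)
Lemma sparse_family h (U : {set T}) : s <= (delta / 2) ^+ h * #|U|%:R ->
  exists V : nat -> {set T},
    [/\ forall i, (i < 2 ^ h)%N -> V i \subset U,
        forall i, (i < 2 ^ h)%N -> s <= #|V i|%:R &
        forall i j, (i < 2 ^ h)%N -> (j < 2 ^ h)%N -> i != j ->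
          edges R r (V i) (V j) <= 2 ^+ h.+1 * rho * (#|V i|%:R * #|V j|%:R)].
Proof.
elim: h U => [|h IH] U sU.
  exists (fun=> U); rewrite expr0 mul1r in sU; split=> // i j.
  by rewrite !ltnS !leqn0 => /eqP -> /eqP ->.
have d2 : 0 < delta / 2 by rewrite divr_gt0.
have d21 : delta / 2 <= 1 by move: (delta_le1); lra.
have [|A [B [AU BU sA sB AB]]] := sparse_pair (U := U).
  apply: le_trans sU _; rewrite -[leRHS]mul1r ler_wpM2r ?ler0n //.
  by rewrite exprn_ile1 // ltW.
have big (X Y : {set T}) : delta * #|U|%:R <= #|X|%:R ->
    #|X|%:R / 2 <= #|Y|%:R :> R ->
    s <= (delta / 2) ^+ h * #|Y|%:R.
  move=> sX sY; apply: le_trans sU _; rewrite exprSr -mulrA ler_wpM2l //.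
    by rewrite exprn_ge0 // ltW.
  by move: sX sY; lra.
have U0 : 0 < #|U|%:R :> R.
  rewrite lt0r ler0n andbT; apply: contraTneq sU => ->.
  by rewrite mulr0 -ltNge.
have B0 : 0 < #|B|%:R :> R by apply: lt_le_trans sB; rewrite mulr_gt0.
pose A' := [set x in A | deg R r x B <= 2 * rho * #|B|%:R].
have cA' : #|A|%:R / 2 <= #|A'|%:R :> R.
  by apply: low_degree_part AB; rewrite mulr_gt0.
have [V [VA sV VV]] := IH A' (big A A' sA cA').
have VB i : (i < 2 ^ h)%N -> edges R r (V i) B <= 2 * rho * #|B|%:R * #|V i|%:R.
  move=> hi; apply: edges_le_deg => x /(subsetP (VA i hi)).
  by rewrite inE => /andP[].
have V0 i : (i < 2 ^ h)%N -> 0 < #|V i|%:R :> R.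
  by move=> hi; apply: lt_le_trans (sV i hi).
pose t : R := 2 ^+ h.+2 * rho.
have t0 : 0 < t by rewrite mulr_gt0 // exprn_gt0.
pose X (i : 'I_(2 ^ h)) := [set y in B | t * #|V i|%:R < deg R r y (V i)].
pose B' := B :\: \bigcup_i X i.
have cB' : #|B|%:R / 2 <= #|B'|%:R :> R.
  have p2 : (2 ^ h)%:R = 2 ^+ h :> R by rewrite natrX.
  have p20 : 0 < 2 ^+ h :> R by rewrite exprn_gt0.
  have := @card_avoid R T 'I_(2 ^ h) B X (#|B|%:R / (2 * 2 ^+ h)).
  rewrite card_ord p2 -/B' => le; apply: le_trans (le _); last first.
    move=> i; have := few_high_deg r B (V i) (t * #|V i|%:R).
    rewrite -/(X i) edges_sym // => mk.
    have := le_trans mk (VB i (ltn_ord i)).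
    have -> : t * #|V i|%:R * #|X i|%:R =
        2 * rho * #|V i|%:R * (2 * 2 ^+ h * #|X i|%:R).
      by rewrite /t !exprS; ring.
    have -> : 2 * rho * #|B|%:R * #|V i|%:R = 2 * rho * #|V i|%:R * #|B|%:R.
      by ring.
    rewrite ler_pM2l; last by rewrite !mulr_gt0 // V0.
    by rewrite ler_pdivlMr ?mulr_gt0 // mulrC.
  suff -> : 2 ^+ h * (#|B|%:R / (2 * 2 ^+ h)) = #|B|%:R / 2 :> R by lra.
  by field; rewrite gt_eqF.
have [W [WB sW WW]] := IH B' (big B B' sB cB').
have WV i j : (i < 2 ^ h)%N -> (j < 2 ^ h)%N ->
    edges R r (W j) (V i) <= t * (#|W j|%:R * #|V i|%:R).
  move=> hi hj; rewrite [_ * #|V i|%:R]mulrC mulrA; apply: edges_le_deg => y.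
  move/(subsetP (WB j hj)); rewrite inE => /andP[nX yB]; rewrite leNgt.
  apply: contra nX => lt; apply/bigcupP; exists (Ordinal hi) => //.
  by rewrite inE yB.
have wk (x y : R) : x <= 2 ^+ h.+1 * rho * y -> 0 <= y -> x <= t * y.
  move=> le y0; apply: le_trans le _; rewrite /t [2 ^+ h.+2]exprS.
  have : 0 <= 2 ^+ h.+1 * rho * y by rewrite !mulr_ge0 ?exprn_ge0 // ltW.
  lra.
exists (fun i => if (i < 2 ^ h)%N then V i else W (i - 2 ^ h)%N).
have lt2 i : (i < 2 ^ h.+1)%N -> (i < 2 ^ h)%N = false -> (i - 2 ^ h < 2 ^ h)%N.
  move=> hi /negbT; rewrite -leqNgt => le_i.
  by rewrite ltn_subLR // addnn -mul2n -expnS.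
split=> [i hi|i hi|i j hi hj ij].
- case: ifPn => [/VA VAi|/negbTE/(lt2 _ hi)/WB WBi].
    by apply: subset_trans VAi (subset_trans _ AU); apply/subsetP => x;
       rewrite inE => /andP[].
  by apply: subset_trans WBi (subset_trans (subsetDl _ _) BU).
- by case: ifPn => [/sV//|/negbTE/(lt2 _ hi)/sW].
case: ifPn => [ih|nih]; case: ifPn => [jh|njh];
  try (have ih := lt2 _ hi (negbTE nih));
  try (have jh := lt2 _ hj (negbTE njh)).
- by apply: wk; [exact: VV | rewrite mulr_ge0].
- by rewrite edges_sym // [#|V i|%:R * _]mulrC; exact: WV.
- exact: WV.
- apply: wk; last by rewrite mulr_ge0.
  by apply: WW => //; rewrite eqn_sub2rE // leqNgt.
Qed.

End SparseFamily.

(** * The two embedding lemmas *)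

Section Embedding.
Variables (R : realFieldType) (G H : sgraph) (d : nat) (p eta : R) (m : nat).
Hypotheses (jum : jumbled (@edge G) p eta m) (m_gt0 : (0 < m)%N).
Hypothesis mG : (m <= #|G|)%N.
Hypotheses (p_gt0 : 0 < p) (p_half : p <= 1 / 2) (cardH : #|H|%:R * p = 1).
Hypotheses (eta_ge0 : 0 <= eta) (eta_le : eta <= p ^+ 2 / 4).
Hypothesis degH : degenerate d H.

Let z : R := 1 - p.

Let z_gt0 : 0 < z. Proof. by rewrite /z; move: p_half; lra. Qed.
Let z_lt1 : z < 1. Proof. by rewrite /z; move: p_gt0; lra. Qed.
Let p2_gt0 : 0 < p ^+ 2. Proof. by rewrite exprn_gt0. Qed.
Let p2_le : p ^+ 2 <= p / 2.
Proof. by rewrite expr2 ler_pM2l //; move: p_half; lra. Qed.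

(** The proportion of non-neighbours is about [z]; using [z ^+ 2] leaves room
    for all the errors. *)
Definition factor (a : R) (i j : H) : R := if edge i j then a else z ^+ 2.

(** A lower bound for the size of the candidate set of [j] once [s] is
    embedded.  Unlike that size, it does not depend on the images chosen. *)
Definition nominal (N : H -> R) a (s : seq H) (j : H) : R :=
  N j * \prod_(i <- s) factor a i j.

Lemma nominal_rcons (N : H -> R) (a : R) s i j :
  nominal N a (rcons s i) j = nominal N a s j * factor a i j.
Proof. by rewrite /nominal -cats1 big_cat big_seq1 mulrA. Qed.

Lemma nominal_ge (N : H -> R) (a : R) s j : 0 < a <= 1 -> 0 <= N j ->
  (count (edge j) s <= d)%N -> (size s <= #|H|)%N ->
  a ^+ d * z ^+ 2 ^+ #|H| * N j <= nominal N a s j.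
Proof.
case/andP=> a0 a1 N0 cd sH; rewrite /nominal mulrC ler_wpM2l //.
apply: (@le_trans _ _ (a ^+ count (edge j) s * z ^+ 2 ^+ size s)).
  have z2 : 0 <= z ^+ 2 <= 1.
    by rewrite exprn_ge0 ?(ltW z_gt0) // exprn_ile1 ?ltW.
  case/andP: z2 => z20 z21.
  apply: ler_pM; try exact: exprn_ge0 (ltW a0); try exact: exprn_ge0.
    by apply: ler_wiXn2l => //; exact: ltW.
  exact: ler_wiXn2l.
elim: s {cd sH} => [|i s IH] /=; first by rewrite big_nil !expr0 mulr1.
rewrite big_cons {1}/factor (edge_sym i j).
have z21 : z ^+ 2 <= 1 by rewrite exprn_ile1 ?ltW.
have z20 : 0 <= z ^+ 2 by rewrite exprn_ge0 ?ltW.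
have P0 : 0 <= a ^+ count (edge j) s * z ^+ 2 ^+ size s.
  by apply: mulr_ge0; apply: exprn_ge0 => //; exact: ltW.
rewrite [_ ^+ (size s).+1]exprS.
case: (edge j i); rewrite /= ?add1n ?add0n ?(exprS a).
  apply: le_trans (ler_wpM2l (ltW a0) IH).
  rewrite -mulrA ler_wpM2l ?(ltW a0) // ler_wpM2l ?exprn_ge0 ?(ltW a0) //.
  by rewrite ler_piMl // exprn_ge0.
by rewrite mulrCA ler_wpM2l.
Qed.

(** A typical vertex [w] is adjacent to a fraction of only about [p] of [B].
    The difference between [z] and [z ^+ 2] absorbs the error and [w]
    itself. *)
Lemma few_small_nonneighborhoods (A B : {set G}) :
  (m <= #|B|)%N -> 4 <= p * #|B|%:R ->
  #|[set w in A | #|[set x in B | (w != x) && ~~ edge w x]|%:R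
                  < z ^+ 2 * #|B|%:R]|%:R <= m%:R :> R.
Proof.
move=> mB pB; apply: le_trans (jumbled_few_high jum A mB).
rewrite ler_nat; apply/subset_leq_card/subsetP => w; rewrite !inE.
case/andP=> -> /= small.
have : #|B|%:R <= #|[set x in B | (w != x) && ~~ edge w x]|%:R
    + deg R (@edge G) w B + #|[set w]|%:R.
  rewrite /deg -!natrD ler_nat -addnA.
  apply: leq_trans (leq_add (leqnn _) (leq_card_setU _ _)).
  apply: leq_trans (leq_card_setU _ _).
  apply/subset_leq_card/subsetP => x xB; rewrite !inE xB /=.
  by case: (edge w x); rewrite ?orbT //= andbT eq_sym; case: eqP.
rewrite cards1.
have hp : p * #|B|%:R * (1 / 2) <= p * #|B|%:R * z.
  by rewrite ler_wpM2l ?(le_trans _ pB) // /z; move: p_half; lra.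
have he : eta * #|B|%:R <= p / 8 * #|B|%:R.
  rewrite ler_wpM2r ?ler0n //; move: eta_le p2_le; lra.
move: small; rewrite [z ^+ 2]expr2 {1}/z.
have -> : (1 - p) * z * #|B|%:R = (1 - p) * #|B|%:R - p * #|B|%:R * z.
  by rewrite /z; ring.
move: pB hp he; lra.
Qed.

(** Greedy embedding along a degenerate order.  At most [d] neighbours of a
    vertex come before it, so its candidate set never shrinks by more than
    [a ^+ d * z ^+ 2 ^+ #|H|].  The property [Q] stands for what else has to be
    maintained. *)
Lemma greedy_nominal (r : rel G) (N : H -> R) (a : R)
    (Q : seq H -> (H -> {set G}) -> Prop) (C0 : H -> {set G}) (x0 : G) :
  symmetric r -> 0 < a <= 1 -> (forall j, 0 <= N j <= #|C0 j|%:R) ->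
  Q [::] C0 ->
  (forall s1 i (C : H -> {set G}), i \notin s1 -> (size s1 < #|H|)%N ->
     Q s1 C ->
     (forall j, j \notin s1 -> a ^+ d * z ^+ 2 ^+ #|H| * N j
        <= nominal N a s1 j <= #|C j|%:R) ->
     exists w, [/\ w \in C i,
       forall j, j \notin s1 ->
         factor a i j * #|C j|%:R <= #|shrink r i w C j|%:R &
       Q (rcons s1 i) (shrink r i w C)]) ->
  exists phi : H -> G, forall u v, u != v -> embedded_pair r phi u v.
Proof.
move=> r_sym a01 NC0 Q0 step.
have [s [s_uniq s_all s_deg]] := degenerate_order degH.
pose Inv s1 (C : H -> {set G}) := Q s1 C /\
  forall j, j \notin s1 -> nominal N a s1 j <= #|C j|%:R.
apply: (greedy_embedding (s := s) (Inv := Inv) (C0 := C0) r_sym x0) => //.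
  split=> // j _; rewrite /nominal big_nil mulr1.
  by case/andP: (NC0 j).
move=> s1 i s2 C def_s [QC Cnom].
have i_s1 : i \notin s1.
  move: s_uniq; rewrite def_s cat_uniq => /and3P[_ /hasPn h _].
  by apply: h; rewrite inE eqxx.
have size_s1 : (size s1 < #|H|)%N.
  apply: (@leq_trans (size s)).
    by rewrite def_s size_cat /= addnS ltnS leq_addr.
  by rewrite -(card_uniqP s_uniq) max_card.
have [|w [wC Cw Qw]] := step s1 i C i_s1 size_s1 QC.
  move=> j js1; rewrite Cnom // andbT.
  case/andP: (NC0 j) => N0 _; apply: nominal_ge => //; last exact: ltnW.
  apply: (s_deg _ _ _ def_s); have := s_all j.
  by rewrite def_s mem_cat (negPf js1).
exists w => //; split=> // j; rewrite mem_rcons inE negb_or => /andP[_ js1].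
apply: le_trans (Cw j js1); rewrite nominal_rcons mulrC ler_wpM2l ?Cnom //.
rewrite /factor; case/andP: a01 => a0 _.
by case: ifP => _; rewrite ?(ltW a0) // exprn_ge0 ?ltW.
Qed.

(** For each later neighbour [j] of [i], the candidates for [i] of low r-degree
    into [C j] form a set which is too sparse to [C j] to have
    [delta * #|U|] elements; so few candidates for [i] are bad, and [L], the
    least size of a candidate set, exceeds their number. *)
Lemma dense_embedding (r : rel G) (U : {set G}) (rho delta : R) :
  symmetric r -> 0 < rho <= 1 ->
  (forall A B : {set G}, A \subset U -> B \subset U ->
    delta * #|U|%:R <= #|A|%:R -> delta * #|U|%:R <= #|B|%:R ->
    rho * (#|A|%:R * #|B|%:R) <= edges R r A B) ->
  let L := rho ^+ d * z ^+ 2 ^+ #|H| * #|U|%:R in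
  0 < delta * #|U|%:R <= p * L / 4 -> 4 * m%:R <= p * L ->
  exists phi : H -> G, forall u v, u != v -> embedded_pair r phi u v.
Proof.
move=> r_sym rho01 dense L /andP[dU0 dU] mL.
have m1 : 1 <= m%:R :> R by rewrite ler1n.
have pL : 4 <= p * L by move: mL m1; lra.
have L0 : 0 < L by rewrite -(pmulr_rgt0 _ p_gt0); move: pL; lra.
have Lp : p * L <= L / 2 by rewrite mulrC ler_pM2l //; move: p_half; lra.
have U0 : (0 < #|U|)%N.
  rewrite -(ltr_nat R) lt0r ler0n andbT; apply: contraTneq dU0 => ->.
  by rewrite mulr0 ltxx.
have /card_gt0P[x0 _] := U0.
apply: (greedy_nominal (N := fun=> #|U|%:R) (C0 := fun=> U)
  (Q := fun _ C => forall j, C j \subset U) x0 r_sym rho01) => //.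
  by move=> _; rewrite ler0n lexx.
move=> s1 i C i_s1 _ CU Cnom.
have CL j : j \notin s1 -> L <= #|C j|%:R.
  by move=> /Cnom/andP[]; exact: le_trans.
have Cm j : j \notin s1 -> (m <= #|C j|)%N.
  by move=> js1; rewrite -(ler_nat R); have := CL j js1; move: mL Lp L0; lra.
have pC j : j \notin s1 -> 4 <= p * #|C j|%:R.
  by move=> js1; apply: le_trans pL _; rewrite ler_wpM2l ?CL // ltW.
pose Bad j := if j \in s1 then set0 else if edge i j
  then [set w in C i | deg R r w (C j) < rho * #|C j|%:R]
  else [set w in C i | #|[set x in C j | (w != x) && ~~ edge w x]|%:R
                  < z ^+ 2 * #|C j|%:R].
have cBad j : #|Bad j|%:R <= delta * #|U|%:R + m%:R.
  rewrite /Bad; case: ifPn => js1; first by rewrite cards0 addr_ge0 ?ler0n ?ltW.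
  case: ifP => ij; last first.
    apply: le_trans (few_small_nonneighborhoods _ (Cm _ js1) (pC _ js1)) _.
    by rewrite lerDr ltW.
  apply: (@le_trans _ _ (delta * #|U|%:R)); last by rewrite lerDl ler0n.
  apply/ltW/few_low_deg => // A' A'C bigA'.
  rewrite -mulrA [#|C j|%:R * _]mulrC; apply: dense => //.
    exact: subset_trans A'C (CU i).
  by apply: le_trans dU _; have := CL _ js1; move: Lp L0; lra.
have [w] : exists w, w \in C i :\: \bigcup_j Bad j.
  apply/set0Pn; rewrite -card_gt0 -(ltr_nat R).
  apply: lt_le_trans (card_avoid (C i) cBad).
  have := CL i i_s1; have : #|H|%:R * (delta * #|U|%:R + m%:R) <= L / 2.
    have -> : L / 2 = #|H|%:R * (p * L / 2) by rewrite mulrA mulrA cardH mul1r.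
    by rewrite ler_wpM2l ?ler0n //; move: dU mL; lra.
  by move: L0; lra.
rewrite inE => /andP[notBad wC]; exists w; split=> // j; last first.
  apply: subset_trans (CU j); rewrite /shrink.
  by case: ifP => _; apply/subsetP => x; rewrite inE => /andP[].
move=> js1.
have : w \notin Bad j by apply: contra notBad => wB; apply/bigcupP; exists j.
rewrite /Bad (negPf js1) /factor /shrink.
by case: (edge i j); rewrite inE wC /= -leNgt.
Qed.

(** There are [p ^- 2] pairs of vertices of [H]. *)
Lemma sum_pred_pair_le (P : pred (H * H)) (F : H * H -> R) (t : R) :
  0 <= t -> (forall x, P x -> F x <= t) -> \sum_(x | P x) F x <= t / p ^+ 2.
Proof.
move=> t0 Ft; apply: le_trans (ler_sum _ Ft) _.
rewrite sumr_const -[t *+ _]mulr_natr.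
rewrite ler_wpM2l // -[leRHS]mul1r ler_pdivlMr //.
apply: (@le_trans _ _ ((#|H| * #|H|)%:R * p ^+ 2)).
  rewrite ler_wpM2r ?(ltW p2_gt0) // ler_nat -card_prod.
  exact: max_card.
by rewrite natrM expr2 mulrACA cardH mulr1.
Qed.

Let q : R := p / z.

Let q_gt0 : 0 < q. Proof. exact: divr_gt0. Qed.

Definition edge_factor (i j : H) : R := if edge i j then q else 1.

(** Choosing the image of [i] at random, the number of r-edges between the
    candidates for [j] and [j'] drops by a factor of about [p] for each of the
    two that is adjacent to [i]. *)
Lemma sum_shrunk_edges_le (r b : rel G) (C : H -> {set G}) i j j' :
  symmetric r -> subrel b (@edge G) ->
  4 * m%:R <= p ^+ 2 * #|C i|%:R :> R ->
  \sum_(w in C i) edges R r (shrink b i w C j) (shrink b i w C j') <=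
  #|C i|%:R * (edge_factor i j * edge_factor i j' *
     (edges R r (C j) (C j') + 5 * m%:R * #|G|%:R / p ^+ 2)).
Proof.
move=> r_sym b_sub mC; set A := C i.
have A0 : 0 <= #|A|%:R :> R by rewrite ler0n.
have m0 : 0 <= m%:R :> R by rewrite ler0n.
have z1 : z * (1 + p) <= 1.
  by rewrite /z -subr_sqr expr1n; move: p2_gt0; lra.
have q_ge : p + p ^+ 2 <= q.
  rewrite /q ler_pdivlMr //.
  have -> : (p + p ^+ 2) * z = p * (z * (1 + p)) by ring.
  by rewrite ler_piMr // ltW.
have q1 : q <= 1 by rewrite /q ler_pdivrMr // mul1r /z; move: p_half; lra.
have peta : p + eta <= q by move: q_ge eta_le p2_gt0; lra.
have peta0 : 0 <= p + eta by move: p_gt0 eta_ge0; lra.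
have pq : p <= q by move: q_ge p2_gt0; lra.
have mA : (m <= #|A|)%N.
  rewrite -(ler_nat R); have : p ^+ 2 * #|A|%:R <= 1 * #|A|%:R.
    by rewrite ler_wpM2r //; move: p2_le p_half; lra.
  by move: mC m0; rewrite -/A; lra.
have qA : (p + eta) * #|A|%:R + m%:R <= q * #|A|%:R.
  have : (p + eta + p ^+ 2 / 4) * #|A|%:R <= q * #|A|%:R.
    by rewrite ler_wpM2r //; move: q_ge eta_le p2_gt0; lra.
  by move: mC; rewrite -/A; lra.
have E0 : 0 <= 5 * m%:R * #|G|%:R / p ^+ 2.
  by apply: divr_ge0 (ltW p2_gt0); rewrite -!natrM ler0n.
have sub_nbr w k : edge i k ->
    shrink b i w C k \subset [set x in C k | edge w x].
  move=> ik; rewrite /shrink ik; apply/subsetP => x; rewrite !inE.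
  by case/andP=> -> /b_sub.
have sub_all w k : shrink b i w C k \subset C k.
  rewrite /shrink; case: ifP => _; apply/subsetP => x;
    by rewrite inE => /andP[].
rewrite /edge_factor; case: ifPn => ij; case: ifPn => ij'.
- rewrite -expr2.
  apply: le_trans (sum_edges_both_le (@edge_sym G) jum mG peta0 r (C j) (C j')
    mA qA peta pq q1 p_gt0).
  by apply: ler_sum => w _; apply: edges_sub; exact: sub_nbr.
- rewrite mulr1.
  apply: le_trans (sum_edges_one_le (@edge_sym G) jum peta0 r (C j) (C j')
    mA qA pq q1 p_gt0).
  by apply: ler_sum => w _; apply: edges_sub; [exact: sub_nbr|exact: sub_all].
- rewrite mul1r [edges R r (C j) _]edges_sym //.
  apply: le_trans (sum_edges_one_le (@edge_sym G) jum peta0 r (C j') (C j)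
    mA qA pq q1 p_gt0).
  apply: ler_sum => w _; rewrite edges_sym //.
  by apply: edges_sub; [exact: sub_nbr|exact: sub_all].
- rewrite !mul1r.
  apply: (@le_trans _ _ (\sum_(w in A) edges R r (C j) (C j'))).
    by apply: ler_sum => w _; apply: edges_sub; exact: sub_all.
  rewrite sumr_const -[_ *+ #|A|]mulr_natl ler_wpM2l // lerDl //.
Qed.

Let edge_factor_le (i j : H) :
  edge_factor i j <= z^-1 ^+ 3 * factor (p * z ^+ 2) i j.
Proof.
have zu : z^-1 * z = 1 by rewrite mulVf // gt_eqF.
rewrite /edge_factor /factor; case: ifP => _.
  have -> : z^-1 ^+ 3 * (p * z ^+ 2) = q * (z^-1 * z) ^+ 2 by rewrite /q; ring.
  by rewrite zu expr1n mulr1.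
have -> : z^-1 ^+ 3 * z ^+ 2 = z^-1 * (z^-1 * z) ^+ 2 by ring.
by rewrite zu expr1n mulr1 invf_ge1 ?ltW.
Qed.

(** The potential [\sum Phi] adds up the r-densities between the candidate sets
    of the adjacent pairs not yet embedded, with the guaranteed sizes in place
    of the actual ones: its expectation can then be computed edge by edge.
    While it is small, most candidates for [i] have few r-edges into each
    candidate set of a neighbour.  By averaging over these candidates, one of
    them multiplies the potential by at most [z ^- 8]: a factor [z ^- 3] for
    each of the two sides comes from the gap between [q] and the factor
    [p * z ^+ 2] (or between [1] and [z ^+ 2]), one factor [z ^- 1] absorbs
    the additive error, and one pays for the exclusion of the bad candidates.
    As [z ^+ #|H|] is bounded below, the potential grows by a bounded factor
    in total. *)
Lemma sparse_embedding (r : rel G) (V : H -> {set G}) (kappa s : R) :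
  symmetric r -> subrel r (@edge G) -> 0 < kappa -> 0 < s ->
  (forall j, s <= #|V j|%:R) ->
  (forall j j', edge j j' -> edges R r (V j) (V j')
     <= kappa * (#|V j|%:R * #|V j'|%:R)) ->
  let L := (p * z ^+ 2) ^+ d * z ^+ 2 ^+ #|H| * s in
  let theta := kappa / p ^+ 2 in
  4 * m%:R <= p ^+ 2 * L ->
  theta * z^-1 ^+ (8 * #|H|) <= p ^+ 4 / 4 ->
  5 * m%:R * #|G|%:R / p ^+ 2 / p ^+ 2 <= p * theta * L ^+ 2 ->
  exists phi : H -> G, forall u v, u != v ->
    embedded_pair (fun x y => edge x y && ~~ r x y) phi u v.
Proof.
move=> r_sym r_sub k0 s0 Vs Vsparse L theta mL theta_end err.
pose b : rel G := fun x y => edge x y && ~~ r x y; rewrite -/b.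
have b_sym : symmetric b by move=> x y; rewrite /b r_sym edge_sym.
have b_sub : subrel b (@edge G) by move=> x y /andP[].
have z2_0 : 0 < z ^+ 2 by rewrite exprn_gt0.
have z2_1 : z ^+ 2 <= 1 by rewrite exprn_ile1 ?ltW.
pose a := p * z ^+ 2.
have a0 : 0 < a by rewrite mulr_gt0.
have a01 : 0 < a <= 1.
  by rewrite a0 /a mulr_ile1 ?(ltW p_gt0) ?(ltW z2_0) //; move: p_half; lra.
have c0 : 0 < a ^+ d * z ^+ 2 ^+ #|H| by rewrite mulr_gt0 ?exprn_gt0.
have L0 : 0 < L by rewrite mulr_gt0.
have theta0 : 0 < theta by rewrite divr_gt0.
have zV0 : 0 < z^-1 by rewrite invr_gt0.
have zV1 : 1 <= z^-1 by rewrite invf_ge1 ?ltW.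
pose P (s1 : seq H) (x : H * H) :=
  [&& x.1 \notin s1, x.2 \notin s1 & edge x.1 x.2].
pose nom := nominal (fun j => #|V j|%:R) a.
pose Phi s1 (C : H -> {set G}) (x : H * H) : R :=
  edges R r (C x.1) (C x.2) / (nom s1 x.1 * nom s1 x.2).
pose Q s1 C := \sum_(x | P s1 x) Phi s1 C x <= theta * z^-1 ^+ (8 * size s1).
have /card_gt0P[x0 _] : (0 < #|G|)%N by exact: leq_trans mG.
apply: (greedy_nominal (N := fun j => #|V j|%:R) (C0 := V) (Q := Q) x0
  b_sym a01).
- by move=> j; rewrite ler0n lexx.
- rewrite /Q muln0 expr0 mulr1; apply: sum_pred_pair_le => [|x /and3P[_ _ xE]].
    exact: ltW.
  have V0 j : 0 < #|V j|%:R :> R by exact: lt_le_trans (Vs j).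
  rewrite /Phi /nom /nominal !big_nil !mulr1 ler_pdivrMr ?mulr_gt0 //.
  exact: Vsparse.
move=> s1 i C i_s1 size_s1 QC Cnom.
have nomL j : j \notin s1 -> L <= nom s1 j.
  move=> /Cnom/andP[le _]; apply: le_trans le.
  by rewrite ler_wpM2l ?(ltW c0).
have nomC j : j \notin s1 -> nom s1 j <= #|C j|%:R by move=> /Cnom/andP[].
have CL j : j \notin s1 -> L <= #|C j|%:R.
  by move=> js1; exact: le_trans (nomL j js1) (nomC j js1).
have nom0 j : j \notin s1 -> 0 < nom s1 j by move/nomL; exact: lt_le_trans.
set A := C i; have A0 : 0 < #|A|%:R :> R by exact: lt_le_trans (CL i i_s1).
pose th := theta * z^-1 ^+ (8 * size s1).
have th_ge : theta <= th by rewrite ler_peMr ?exprn_ege1 ?(ltW theta0).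
have th_le : th <= p ^+ 4 / 4.
  apply: le_trans theta_end; rewrite ler_wpM2l ?(ltW theta0) //.
  by rewrite ler_weXn2l // leq_mul2l ltnW.
have Phi0 s' C' x : (forall j, j \notin s' -> 0 < nom s' j) -> P s' x ->
    0 <= Phi s' C' x.
  move=> n0 /and3P[x1 x2 _].
  by rewrite divr_ge0 ?edges_ge0 // mulr_ge0 // ltW // n0.
have Phi_th x : P s1 x -> Phi s1 C x <= th.
  move=> Px; apply: le_trans QC; rewrite (bigD1 x) //= lerDl.
  by apply: sumr_ge0 => y /andP[Py _]; exact: Phi0.
have mp : 4 * m%:R <= p * L :> R.
  apply: le_trans mL _; rewrite ler_wpM2r ?(ltW L0) //.
  by move: p2_le p_gt0; lra.
have m1 : 1 <= m%:R :> R by rewrite ler1n.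
have Cm j : j \notin s1 -> (m <= #|C j|)%N.
  move=> js1; rewrite -(ler_nat R); have := CL j js1.
  have : p * L <= 1 * L by rewrite ler_wpM2r ?(ltW L0) //; move: p_half; lra.
  by move: mp m1; lra.
have pC j : j \notin s1 -> 4 <= p * #|C j|%:R.
  move=> js1; have : p * L <= p * #|C j|%:R by rewrite ler_wpM2l ?CL ?ltW.
  by move: mp m1; lra.
have mA : 4 * m%:R <= p ^+ 2 * #|A|%:R :> R.
  by apply: le_trans mL _; rewrite ler_wpM2l ?CL ?ltW.
(* A loss of [p ^+ 2 / 2] for the r-degrees and of [eta] for the degrees
   leaves more than the factor [p * z ^+ 2]. *)
pose Bad j := if j \in s1 then set0 else if edge i j
  then [set w in A | deg R (@edge G) w (C j) < (p - eta) * #|C j|%:R] :|: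
       [set w in A | p ^+ 2 / 2 * #|C j|%:R < deg R r w (C j)]
  else [set w in A | #|[set x in C j | (w != x) && ~~ edge w x]|%:R
                  < z ^+ 2 * #|C j|%:R].
have cBad j : #|Bad j|%:R <= p ^+ 2 * #|A|%:R.
  have m_le : m%:R <= p ^+ 2 / 4 * #|A|%:R by move: mA; lra.
  have p2A : 0 <= p ^+ 2 * #|A|%:R by rewrite mulr_ge0 ?ltW.
  rewrite /Bad; case: ifPn => js1; first by rewrite cards0.
  case: ifP => ij; last first.
    apply: le_trans (few_small_nonneighborhoods _ (Cm _ js1) (pC _ js1)) _.
    by move: m_le p2A; lra.
  have lowj := jumbled_few_low jum m_gt0 A (Cm _ js1).
  have := few_high_deg r A (C j) (p ^+ 2 / 2 * #|C j|%:R).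
  move: lowj; set X := [set w in A | deg R (@edge G) w (C j) < _].
  set Y := [set w in A | _ < deg R r w (C j)] => lowj highj.
  have e_le : edges R r A (C j) <= th * (#|A|%:R * #|C j|%:R).
    have : P s1 (i, j) by rewrite /P /= i_s1 js1.
    have nn0 : 0 < nom s1 i * nom s1 j.
      exact: mulr_gt0 (nom0 _ i_s1) (nom0 _ js1).
    move/Phi_th; rewrite /Phi /= ler_pdivrMr // => le.
    apply: le_trans le _; rewrite ler_wpM2l ?(le_trans (ltW theta0)) //.
    by rewrite ler_pM ?nomC ?(ltW (nom0 _ _)).
  have C0 : 0 < #|C j|%:R :> R by exact: lt_le_trans (CL j js1).
  have Yle : #|Y|%:R <= p ^+ 2 / 2 * #|A|%:R.
    have : p ^+ 2 / 2 * #|C j|%:R * #|Y|%:R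
        <= p ^+ 4 / 4 * (#|A|%:R * #|C j|%:R).
      apply: le_trans highj (le_trans e_le _).
      by rewrite ler_wpM2r // mulr_ge0 ?ltW.
    have -> : p ^+ 4 / 4 * (#|A|%:R * #|C j|%:R) =
      (p ^+ 2 / 2 * #|C j|%:R) * (p ^+ 2 / 2 * #|A|%:R) by field.
    by rewrite ler_pM2l // mulr_gt0 ?divr_gt0.
  apply: (@le_trans _ _ (#|X|%:R + #|Y|%:R)).
    by rewrite -natrD ler_nat leq_card_setU.
  apply: le_trans (lerD lowj Yle) _.
  by move: m_le p2A; lra.
pose Good := A :\: \bigcup_j Bad j.
have cGood : z * #|A|%:R <= #|Good|%:R.
  apply: le_trans (card_avoid A cBad).
  by rewrite expr2 !mulrA cardH mul1r /z; lra.
have GoodA : Good \subset A by exact: subsetDl.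
pose C' w := shrink b i w C; pose s1' := rcons s1 i.
pose F w := \sum_(x | P s1' x) Phi s1' (C' w) x.
have s1'P j : j \notin s1' -> j \notin s1.
  by rewrite mem_rcons inE negb_or => /andP[].
have nom'0 j : j \notin s1' -> 0 < nom s1' j.
  move/s1'P/nom0 => n0; rewrite /nom nominal_rcons mulr_gt0 //.
  by rewrite /factor; case: ifP.
have F0 w : 0 <= F w by apply: sumr_ge0 => x; exact: Phi0.
pose E : R := 5 * m%:R * #|G|%:R / p ^+ 2.
have E0 : 0 <= E by apply: divr_ge0 (ltW p2_gt0); rewrite -!natrM ler0n.
have pair_le x : P s1' x -> \sum_(w in A) Phi s1' (C' w) x <=
    #|A|%:R * z^-1 ^+ 6 * (Phi s1 C x + E / L ^+ 2).
  case: x => j j' Px; have /and3P[/= /s1'P js1 /s1'P js1' jj'] := Px.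
  rewrite /Phi /= -mulr_suml ler_pdivrMr; last first.
    by apply: mulr_gt0; apply: nom'0; [case/and3P: Px | case/and3P: Px].
  apply: le_trans (sum_shrunk_edges_le j j' r_sym b_sub mA) _.
  rewrite /nom !nominal_rcons -/(nom s1 j) -/(nom s1 j').
  set e := edges _ _ _ _; set n := nom s1 j; set n' := nom s1 j'.
  have n0 : 0 < n by exact: nom0.
  have n'0 : 0 < n' by exact: nom0.
  have e0 : 0 <= e by exact: edges_ge0.
  have -> : #|A|%:R * z^-1 ^+ 6 * (e / (n * n') + E / L ^+ 2) *
        (n * factor a i j * (n' * factor a i j')) =
      #|A|%:R * (z^-1 ^+ 3 * factor a i j * (z^-1 ^+ 3 * factor a i j') *
        (e * (n * n' / (n * n')) + E * (n * n' / L ^+ 2))) by ring.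
  rewrite divff ?mulr1; last by rewrite gt_eqF //; exact: mulr_gt0.
  have nn_L : 1 <= n * n' / L ^+ 2.
    rewrite ler_pdivlMr ?exprn_gt0 // mul1r expr2.
    by rewrite ler_pM ?nomL ?(ltW L0).
  rewrite ler_wpM2l ?(ltW A0) //.
  have ef0 k : 0 <= edge_factor i k.
    by rewrite /edge_factor; case: ifP => _ //; exact: ltW.
  apply: ler_pM; rewrite ?mulr_ge0 ?addr_ge0 //.
    by apply: ler_pM => //; exact: edge_factor_le.
  by rewrite lerD2l ler_peMr.
have sumF : \sum_(w in Good) F w <= theta * z^-1 ^+ (8 * size s1') * #|Good|%:R.
  apply: (@le_trans _ _ (\sum_(w in A) F w)); first exact: sum_subset.
  rewrite /F exchange_big /=.
  apply: (@le_trans _ _ (#|A|%:R * z^-1 ^+ 6 * (th + p * theta))).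
    apply: le_trans (ler_sum _ pair_le) _.
    rewrite -mulr_sumr big_split /= ler_wpM2l
      ?mulr_ge0 ?exprn_ge0 ?(ltW A0) ?(ltW zV0) //.
    apply: lerD.
      apply: le_trans QC; rewrite [leRHS](bigID (P s1')) /=.
      rewrite (eq_bigl (fun x => P s1 x && P s1' x)) => [|x].
        by rewrite lerDl; apply: sumr_ge0 => x /andP[Px _]; exact: Phi0.
      apply/idP/andP => [Px|[]//]; split=> //.
      by case/and3P: Px => /s1'P x1 /s1'P x2 xE; rewrite /P x1 x2.
    apply: le_trans (sum_pred_pair_le (P := P s1') (F := fun=> E / L ^+ 2)
      (t := E / L ^+ 2) _ _) _.
    - by rewrite divr_ge0 // exprn_ge0 ?ltW.
    - by [].
    by rewrite mulrAC ler_pdivrMr ?exprn_gt0.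
  have -> : theta * z^-1 ^+ (8 * size s1') = z^-1 ^+ 8 * th.
    by rewrite size_rcons mulnS exprD mulrCA.
  have th0 : 0 <= th by exact: le_trans (ltW theta0) th_ge.
  have step : th + p * theta <= th * z^-1.
    have z1p : 1 + p <= z^-1.
      rewrite -[leRHS]mul1r ler_pdivlMr // mulrC /z -subr_sqr expr1n.
      by move: p2_gt0; lra.
    apply: (@le_trans _ _ (th * (1 + p))); last by rewrite ler_wpM2l.
    by rewrite mulrDr mulr1 lerD2l [leRHS]mulrC ler_wpM2l ?(ltW p_gt0).
  apply: (@le_trans _ _ (#|A|%:R * z^-1 ^+ 6 * (th * z^-1))).
    apply: ler_wpM2l step; apply: mulr_ge0 (ltW A0) _.
    exact: exprn_ge0 (ltW zV0).
  have zu : z^-1 * z = 1 by rewrite mulVf // gt_eqF.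
  apply: (@le_trans _ _ (z^-1 ^+ 8 * th * (z * #|A|%:R))); last first.
    by apply: ler_wpM2l cGood; apply: mulr_ge0 th0; exact: exprn_ge0 (ltW zV0).
  have -> : z^-1 ^+ 8 * th * (z * #|A|%:R) =
    #|A|%:R * z^-1 ^+ 6 * (th * z^-1) * (z^-1 * z) by ring.
  by rewrite zu mulr1.
have Good0 : Good != set0.
  rewrite -card_gt0 -(ltr_nat R); apply: lt_le_trans cGood.
  by rewrite mulr_gt0.
have [w wG Fw] := exists_le_avg Good0 sumF.
move: wG; rewrite inE => /andP[notBad wA]; exists w; split=> // j js1.
have : w \notin Bad j by apply: contra notBad => wB; apply/bigcupP; exists j.
rewrite /Bad (negPf js1) /factor /shrink.
case: (edge i j); last by rewrite inE wA /= -leNgt.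
rewrite !inE wA /= negb_or -!leNgt => /andP[lo hi].
have := deg_split R w (C j) r_sub; rewrite -/b {1}/deg => ->.
have -> : a = p - 2 * p ^+ 2 + p * p ^+ 2 by rewrite /a /z; ring.
have pp : p * p ^+ 2 <= 1 / 2 * p ^+ 2 by rewrite ler_wpM2r ?(ltW p2_gt0).
have : (p - 2 * p ^+ 2 + p * p ^+ 2) * #|C j|%:R
    <= (p - eta - p ^+ 2 / 2) * #|C j|%:R.
  by rewrite ler_wpM2r ?ler0n //; move: pp eta_le p2_gt0; lra.
move: lo hi; lra.
Qed.

End Embedding.

(** * The choice of the colour *)

Lemma Bernoulli_ineq (R : realFieldType) (x : R) n :
  0 <= x <= 1 -> 1 - n%:R * x <= (1 - x) ^+ n.
Proof.
case/andP=> x0 x1; elim: n => [|n IH]; first by rewrite mul0r subr0 expr0.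
rewrite exprS -natr1 mulrDl mul1r.
have nx : 0 <= n%:R * x * x by rewrite !mulr_ge0.
have : (1 - x) * (1 - n%:R * x) <= (1 - x) * (1 - x) ^+ n.
  by rewrite ler_wpM2l // subr_ge0.
apply: le_trans; rewrite mulrBr mulr1 mulrBl mul1r.
by move: nx; rewrite [x * _]mulrC; lra.
Qed.

Section Dichotomy.
Variables (R : realFieldType) (G : sgraph) (k d h m : nat) (eta : R).
Hypotheses (k_ge2 : (2 <= k)%N) (d_ge2 : (2 <= d)%N) (h_ge1 : (1 <= h)%N).
Hypothesis h_le : (2 ^ h <= 2 * k)%N.

Let p : R := k%:R^-1.

Hypotheses (jum : jumbled (@edge G) p eta m) (m_gt0 : (0 < m)%N).
Hypotheses (eta_ge0 : 0 <= eta) (eta_le : eta <= p ^+ 2 / 4).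
Hypothesis m_small : m%:R <= p ^+ (140 * (d * h)) * #|G|%:R :> R.

Let k0 : 0 < k%:R :> R. Proof. by rewrite ltr0n; exact: ltnW. Qed.
Let p_gt0 : 0 < p. Proof. by rewrite invr_gt0. Qed.
Let kp : k%:R * p = 1. Proof. by rewrite divff // gt_eqF. Qed.
Let p_half : p <= 1 / 2.
Proof. by rewrite div1r lef_pV2 ?posrE ?ler_nat // ltr0n. Qed.

Let pX_le a b : (b <= a)%N -> p ^+ a <= p ^+ b.
Proof.
by move=> ba; apply: ler_wiXn2l => //; [exact: ltW | move: p_half; lra].
Qed.

(* (1 - 1/k)^k is bounded below: Bernoulli's inequality gives 1/4 for the
   exponent k/2, rounded up.  As p <= 1/2, this can be written as a power of
   p. *)
Let zX_ge : p ^+ 8 <= (1 - p) ^+ 2 ^+ k.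
Proof.
have p1 : 0 <= p <= 1 by rewrite (ltW p_gt0) /=; move: p_half; lra.
have z0 : 0 <= 1 - p by move: p_half; lra.
have z1 : 1 - p <= 1 by move: p_gt0; lra.
have quarter : 1 / 4 <= (1 - p) ^+ uphalf k.
  apply: le_trans (Bernoulli_ineq _ p1).
  have : (uphalf k)%:R * 2 * p <= (k%:R + 1) * p.
    rewrite ler_wpM2r ?(ltW p_gt0) // -natrM natr1 ler_nat muln2.
    by rewrite -[leqRHS](odd_double_half k.+1) leq_addl.
  by rewrite mulrDl kp; move: p_half; lra.
have : (1 / 4) ^+ 4 <= ((1 - p) ^+ uphalf k) ^+ 4.
  by rewrite lerXn2r ?nnegrE ?exprn_ge0 //; lra.
rewrite -!exprM => le.
apply: (@le_trans _ _ ((1 / 4) ^+ 4)).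
  have -> : (1 / 4) ^+ 4 = (1 / 2) ^+ 8 :> R by field.
  by rewrite lerXn2r ?nnegrE ?(ltW p_gt0) //; lra.
apply: le_trans le _; apply: ler_wiXn2l => //.
rewrite mulnC -[4%N]/(2 * 2)%N mulnA leq_mul2r muln2.
by rewrite -leq_uphalf_double leqnn orbT.
Qed.

Let pX0 n : 0 <= p ^+ n.
Proof. by rewrite exprn_ge0 // ltW. Qed.

Let p24 : 4 * p ^+ 2 <= 1.
Proof.
have : p ^+ 2 <= (1 / 2) ^+ 2.
  by rewrite lerXn2r ?nnegrE ?(ltW p_gt0) //; lra.
lra.
Qed.

(* The potential of [sparse_embedding] starts below (4k rho) / p^2 <= p^38,
   grows by at most z^-8k <= p^-32, and has to stay below p^4 / 4. *)
Let rho : R := p ^+ 43.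
(* In [dense_embedding] the candidate sets may shrink to
   rho^d p^8 = p^(43 d + 8), and [delta] has to be smaller by p^3. *)
Let delta : R := p ^+ (49 * d).
Let s : R := (delta / 2) ^+ h * #|G|%:R.

Let G0 : 0 < #|G|%:R :> R.
Proof.
rewrite -(pmulr_rgt0 _ (exprn_gt0 (140 * (d * h)) p_gt0)).
by apply: lt_le_trans m_small; rewrite ltr0n.
Qed.

Let s_ge : p ^+ (50 * (d * h)) * #|G|%:R <= s.
Proof.
rewrite ler_wpM2r ?(ltW G0) // mulnA exprM; apply: lerXn2r.
- by rewrite nnegrE exprn_ge0 // ltW.
- by rewrite nnegrE divr_ge0 // exprn_ge0 // ltW.
apply: (@le_trans _ _ (p ^+ (49 * d).+1)).
  by apply: pX_le; move: d_ge2; clear; lia.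
rewrite exprSr ler_wpM2l ?exprn_ge0 ?(ltW p_gt0) //; move: p_half; lra.
Qed.

Let dh : (d <= d * h)%N. Proof. exact: leq_pmulr. Qed.

Let m_le a : (a.+2 <= 140 * (d * h))%N -> 4 * m%:R <= p ^+ a * #|G|%:R.
Proof.
move=> le; have : m%:R <= p ^+ a.+2 * #|G|%:R.
  by apply: le_trans m_small _; rewrite ler_wpM2r ?(ltW G0) ?pX_le.
have : (p ^+ a * #|G|%:R) * (4 * p ^+ 2) <= p ^+ a * #|G|%:R.
  by rewrite ler_piMr // mulr_ge0 ?exprn_ge0 ?(ltW p_gt0) ?(ltW G0).
have -> : p ^+ a.+2 = p ^+ a * p ^+ 2 by rewrite -exprD addn2.
set P := p ^+ a; set N := #|G|%:R; lra.
Qed.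

(** The case distinction concerns the host graph only.  In the first case the
    copies use the colour [false], for which the edges of colour [true] play
    the part of the sparse relation. *)
Lemma color_dichotomy (col : {set G} -> bool) :
  exists b : bool, forall H : sgraph, #|H| = k -> degenerate d H ->
    (chromatic_number H <= 2 ^ h)%N -> induced_mono_copy H col b.
Proof.
have delta0 : 0 < delta by rewrite exprn_gt0.
have delta1 : delta <= 1 by rewrite -(expr0 p) pX_le.
have rho0 : 0 < rho by rewrite exprn_gt0.
have rho1 : rho <= 1 by rewrite -(expr0 p) pX_le.
have s0 : 0 < s by apply: lt_le_trans s_ge; rewrite mulr_gt0 ?exprn_gt0.
have mG : (m <= #|G|)%N.
  rewrite -(ler_nat R); apply: le_trans m_small _.
  by rewrite -[leRHS]mul1r ler_wpM2r ?(ltW G0) // -(expr0 p) pX_le.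
pose r := color_rel col true.
have r_sym : symmetric r by exact: color_rel_sym.
have z_ge : p <= 1 - p by move: p_half; lra.
pose sparse_at (U : {set G}) := [exists A : {set G}, exists B : {set G},
  [&& A \subset U, B \subset U, delta * #|U|%:R <= #|A|%:R,
    delta * #|U|%:R <= #|B|%:R &
    edges R r A B <= rho * (#|A|%:R * #|B|%:R)]].
case: (boolP [forall U : {set G}, (s <= #|U|%:R) ==> sparse_at U])
  => [/forallP sp|].
  exists false => H cardH degH chiH.
  have cH : #|H|%:R * p = 1 by rewrite cardH.
  have sparse (U : {set G}) : s <= #|U|%:R -> exists A B : {set G},
      [/\ A \subset U, B \subset U, delta * #|U|%:R <= #|A|%:R,
      delta * #|U|%:R <= #|B|%:R &
      edges R r A B <= rho * (#|A|%:R * #|B|%:R)].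
    move=> sU; have /implyP/(_ sU)/existsP[A /existsP[B /and5P[]]] := sp U.
    by exists A, B.
  have [|V [_ sV VV]] :=
    sparse_family r_sym delta0 delta1 rho0 s0 sparse (h := h) (U := setT).
    by rewrite cardsT.
  have [f [f_lt f_col]] := chromatic_coloring chiH.
  have kappa_ge : 2 ^+ h.+1 * rho <= p ^+ 40.
    have h2k : 2 ^+ h.+1 <= 4 * k%:R :> R.
      by rewrite -natrX -natrM ler_nat expnS -[4%N]/(2 * 2)%N -mulnA leq_mul2l.
    have -> : p ^+ 40 = k%:R ^+ 3 * rho.
      by rewrite /rho -[43%N]/(3 + 40)%N exprD mulrA -exprMn kp expr1n mul1r.
    rewrite ler_wpM2r ?(ltW rho0) //; apply: le_trans h2k _.
    rewrite -natrX -natrM ler_nat expnSr leq_mul2r -[4%N]/(2 ^ 2)%N.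
    by rewrite leq_exp2r // k_ge2 orbT.
  pose L := (p * (1 - p) ^+ 2) ^+ d * (1 - p) ^+ 2 ^+ #|H| * s.
  have L_ge : p ^+ (57 * (d * h)) * #|G|%:R <= L.
    apply: (@le_trans _ _
        (p ^+ (3 * d) * p ^+ 8 * (p ^+ (50 * (d * h)) * #|G|%:R))).
      rewrite mulrA -!exprD ler_wpM2r ?(ltW G0) // pX_le //.
      by move: d_ge2 dh; clear; lia.
    apply: ler_pM => //; [exact: mulr_ge0 | exact: mulr_ge0 (ltW G0) | ].
    apply: ler_pM; rewrite ?pX0 ?cardH //.
    rewrite exprM; apply: lerXn2r; first by rewrite nnegrE.
      rewrite nnegrE; apply: mulr_ge0 (ltW p_gt0) _.
      by apply: exprn_ge0; apply: le_trans (ltW p_gt0) z_ge.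
    rewrite exprS ler_wpM2l ?(ltW p_gt0) //.
    apply: lerXn2r => //; rewrite nnegrE ?(ltW p_gt0) //.
    exact: le_trans (ltW p_gt0) z_ge.
  have L0 : 0 < L by apply: lt_le_trans L_ge; rewrite mulr_gt0 ?exprn_gt0.
  have theta_eq : p ^+ 40 / p ^+ 2 = p ^+ 38.
    by rewrite -[40%N]/(38 + 2)%N exprD mulfK // expf_neq0 // gt_eqF.
  have [||||phi emb] := @sparse_embedding R G H d p eta m jum m_gt0 mG p_gt0
    p_half cH eta_ge0 eta_le degH r (fun j => V (f j)) (p ^+ 40) s r_sym
    (@color_rel_sub _ _ _) (exprn_gt0 _ p_gt0) s0 (fun j => sV _ (f_lt j)).
  - move=> j j' jj'.
    apply: le_trans (VV _ _ (f_lt j) (f_lt j') (f_col _ _ jj')) _.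
    by rewrite ler_wpM2r // mulr_ge0.
  - apply: (@le_trans _ _ (p ^+ (2 + 57 * (d * h)) * #|G|%:R)).
      by apply: m_le; move: d_ge2 dh; clear; lia.
    by rewrite exprD -mulrA ler_wpM2l // exprn_ge0 // ltW.
  - rewrite theta_eq cardH exprVn.
    have -> : (1 - p) ^+ (8 * k) = ((1 - p) ^+ 2 ^+ k) ^+ 4.
      by rewrite -!exprM; congr (_ ^+ _); clear; lia.
    have y_ge : (p ^+ 8) ^+ 4 <= ((1 - p) ^+ 2 ^+ k) ^+ 4.
      by apply: lerXn2r; rewrite ?nnegrE // (le_trans _ zX_ge).
    rewrite ler_pdivrMr; last by apply: lt_le_trans y_ge; rewrite !exprn_gt0.
    apply: le_trans (ler_wpM2l _ y_ge); last by rewrite divr_ge0.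
    have -> : p ^+ 38 = p ^+ 4 * p ^+ 2 * (p ^+ 8) ^+ 4.
      by rewrite -exprM -!exprD.
    apply: ler_wpM2r; first exact: exprn_ge0 (pX0 8).
    have := ler_wpM2l (pX0 4) p24; lra.
  - rewrite theta_eq -/L !ler_pdivrMr ?exprn_gt0 //.
    pose a := (44 + 114 * (d * h))%N.
    have am : 4 * m%:R <= p ^+ a * #|G|%:R.
      by apply: m_le; rewrite /a; move: d_ge2 dh; clear; lia.
    have L2 : p ^+ (114 * (d * h)) * #|G|%:R ^+ 2 <= L ^+ 2.
      have := L_ge; rewrite -(@ler_pXn2r _ 2) ?nnegrE ?(ltW L0) ?mulr_ge0 //.
      by rewrite exprMn -exprM mulnAC.
    apply: (@le_trans _ _ (p ^+ 43 * (p ^+ (114 * (d * h)) * #|G|%:R ^+ 2))).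
      have : 5 * m%:R * #|G|%:R <= 2 * (p ^+ a * #|G|%:R) * #|G|%:R.
        by rewrite ler_wpM2r //; move: am (ler0n R m); lra.
      move/le_trans; apply.
      have aE : p ^+ a = p * (p ^+ 43 * p ^+ (114 * (d * h))).
        by rewrite -exprD -exprS.
      have a2 : p ^+ a * 2 <= p ^+ 43 * p ^+ (114 * (d * h)).
        rewrite aE mulrAC; apply: ler_piMl.
          exact: mulr_ge0 (pX0 _) (pX0 _).
        by move: p_half; lra.
      set y := p ^+ (114 * (d * h)) in a2 *; set N := #|G|%:R.
      have -> : 2 * (p ^+ a * N) * N = p ^+ a * 2 * (N * N) by ring.
      have -> : p ^+ 43 * (y * N ^+ 2) = p ^+ 43 * y * (N * N) by ring.
      by apply: ler_wpM2r a2; rewrite mulr_ge0.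
    apply: le_trans (ler_wpM2l (pX0 43) L2) _.
    by rewrite le_eqVlt; apply/orP; left; apply/eqP; ring.
  apply: (mono_copy_of_embedding (phi := phi)) => u v /emb.
  rewrite /embedded_pair; case: ifP => // _.
  by rewrite /r /color_rel; case: (edge (phi u) (phi v)) => //; case: (col _).
rewrite negb_forall => /existsP[U]; rewrite negb_imply => /andP[sU dense].
exists true => H cardH degH _.
have cH : #|H|%:R * p = 1 by rewrite cardH.
have U0 : 0 < #|U|%:R :> R by exact: lt_le_trans sU.
have [||||phi emb] := @dense_embedding R G H d p eta m jum m_gt0 p_gt0 p_half
    cH eta_le degH r U rho delta r_sym.
- by rewrite rho0.
- move=> A B AU BU sA sB; rewrite leNgt; apply: contra dense => lt.
  apply/existsP; exists A; apply/existsP; exists B.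
  by rewrite AU BU sA sB ltW.
- rewrite mulr_gt0 //= mulrA mulrA mulrAC ler_wpM2r ?(ltW U0) //.
  have c_ge : p ^+ (43 * d + 8) <= rho ^+ d * (1 - p) ^+ 2 ^+ #|H|.
    by rewrite exprD cardH /rho -exprM ler_wpM2l ?pX0.
  apply: (@le_trans _ _ (p ^+ (43 * d + 8).+3)).
    by rewrite pX_le //; move: d_ge2; clear; lia.
  have -> : p ^+ (43 * d + 8).+3 = p * p ^+ 2 * p ^+ (43 * d + 8).
    by rewrite -exprS -exprD.
  have -> : p * rho ^+ d * (1 - p) ^+ 2 ^+ #|H| / 4 =
    p / 4 * (rho ^+ d * (1 - p) ^+ 2 ^+ #|H|) by ring.
  apply: ler_pM => //; rewrite ?mulr_ge0 ?(ltW p_gt0) //.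
  by rewrite ler_wpM2l ?(ltW p_gt0) //; move: p24; lra.
- have c_ge : p ^+ (43 * d + 8) <= rho ^+ d * (1 - p) ^+ 2 ^+ #|H|.
    by rewrite exprD cardH /rho -exprM ler_wpM2l ?pX0.
  apply: (@le_trans _ _ (p ^+ (43 * d + 8 + 50 * (d * h)).+1 * #|G|%:R)).
    by apply: m_le; move: d_ge2 dh; clear; lia.
  rewrite exprS -mulrA ler_wpM2l ?(ltW p_gt0) // exprD -mulrA.
  apply: ler_pM => //; first by rewrite mulr_ge0.
  exact: le_trans s_ge sU.
by apply: (mono_copy_of_embedding (phi := phi)).
Qed.

End Dichotomy.

(** * From densities to edge counts, and conclusion *)

Lemma edge_density_edges (R : realFieldType) (G : sgraph) (A B : {set G}) :
  #|[set xy in setX A B | edge xy.1 xy.2]|%:R = edges R (@edge G) A B.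
Proof.
rewrite /edges; under eq_bigr do rewrite degE.
rewrite pair_big_dep /= -sum1_card natr_sum big_mkcond [RHS]big_mkcond /=.
apply: eq_bigr => -[x y] _; rewrite !inE /=.
by case: (x \in A); case: (y \in B); case: (edge x y).
Qed.

(** For sets with at least [m] elements the square root is at least [m]. *)
Lemma pseudo_random_jumbled (R : realType) (G : sgraph) (p lambda eta : R) m :
  (0 < m)%N -> 0 <= lambda -> lambda <= eta * m%:R ->
  pseudo_random p lambda G -> jumbled (@edge G) p eta m.
Proof.
move=> m0 lambda0 le_eta pr A B mA mB.
have m0R : 0 < m%:R :> R by rewrite ltr0n.
have mAR : m%:R <= #|A|%:R :> R by rewrite ler_nat.
have mBR : m%:R <= #|B|%:R :> R by rewrite ler_nat.
have A0 : 0 < #|A|%:R :> R by exact: lt_le_trans mAR.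
have B0 : 0 < #|B|%:R :> R by exact: lt_le_trans mBR.
have AB0 : 0 < #|A|%:R * #|B|%:R :> R by rewrite mulr_gt0.
have A_n0 : A != set0 by rewrite -card_gt0 -(ltr_nat R).
have B_n0 : B != set0 by rewrite -card_gt0 -(ltr_nat R).
have sqrt_ge : m%:R <= Num.sqrt (#|A|%:R * #|B|%:R) :> R.
  rewrite -(ger0_norm (ltW m0R)) -sqrtr_sqr ler_sqrt ?(ltW AB0) //.
  by rewrite expr2 ler_pM ?(ltW m0R).
have : `|edge_density R A B - p| <= eta.
  apply: le_trans (pr A B A_n0 B_n0) _.
  rewrite ler_pdivrMr; last exact: lt_le_trans sqrt_ge.
  apply: le_trans (le_eta) _; rewrite ler_wpM2l //.
  by rewrite -(pmulr_lge0 _ m0R); exact: le_trans le_eta.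
rewrite /edge_density edge_density_edges ler_norml => /andP[lo hi].
apply/andP; split.
  by rewrite -ler_pdivlMr //; lra.
by rewrite -ler_pdivrMr //; lra.
Qed.

Theorem theorem1p4 (R : realType) :
  exists c : R, forall k d chi : nat,
    (2 <= k)%N -> (2 <= d)%N -> (2 <= chi)%N ->
    forall G : sgraph,
      k%:R `^ (c * d%:R * log2 chi%:R) <= #|G|%:R :> R ->
      pseudo_random (1 / k%:R) (#|G|%:R `^ (9 / 10) : R) G ->
      (forall (col : {set G} -> bool) (H : sgraph),
         #|H| = k -> degenerate d H -> (chromatic_number H <= chi)%N ->
         exists b : bool, induced_mono_copy H col b) /\
      (forall col : {set G} -> bool, exists b : bool, forall H : sgraph,
         #|H| = k -> degenerate d H -> (chromatic_number H <= chi)%N ->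
         induced_mono_copy H col b).
Proof.
(* 2800 = 20 * 140, and the rounded-up logarithm is at most twice log2 chi. *)
exists (2800 * 2) => k d chi k2 d2 chi2 G nG prG.
suff same_color : forall col : {set G} -> bool, exists b : bool,
    forall H : sgraph, #|H| = k -> degenerate d H ->
    (chromatic_number H <= chi)%N -> induced_mono_copy H col b.
  split=> // col H cardH degH chiH; have [b copies] := same_color col.
  by exists b; exact: copies.
(* A graph on k vertices has chromatic number at most k, so chi may be
   replaced by min(chi, k); this keeps 2^h <= 2k. *)
pose q := minn chi k; have q2 : (2 <= q)%N by rewrite leq_min chi2.
pose h := up_log 2 q.
have h_gt0 : (0 < h)%N by rewrite up_log_gt0.
have q_le : (q <= 2 ^ h)%N by exact: up_logP.
have lt_q : (2 ^ h.-1 < q)%N by exact: up_log_gtn.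
have h_le : (2 ^ h <= 2 * k)%N.
  rewrite -(prednK h_gt0) expnS leq_mul2l /=; apply: leq_trans (geq_minr chi k).
  exact: ltnW.
have k1 : 1 <= k%:R :> R by rewrite ler1n; exact: ltnW.
have k0 : 0 < k%:R :> R by exact: lt_le_trans k1.
have ln2 : 0 < ln 2 :> R by rewrite ln_gt0 // ltr1n.
have h_log : h%:R <= 2 * log2 chi%:R :> R.
  have log_ge a b : (0 < a)%N -> (a <= b)%N -> ln a%:R <= ln b%:R :> R.
    by move=> a0 ab; rewrite ler_ln ?posrE ?ltr0n ?ler_nat // (leq_trans a0).
  rewrite /log2 mulrA ler_pdivlMr //.
  have l1 : h.-1%:R * ln 2 <= ln chi%:R :> R.
    rewrite mulr_natl -lnXn ?ltr0n // -natrX; apply: log_ge.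
      by rewrite expn_gt0.
    exact: leq_trans (ltnW lt_q) (geq_minl _ _).
  have l2 : ln 2 <= ln chi%:R :> R by exact: (log_ge 2%N).
  by rewrite -(prednK h_gt0) -natr1 mulrDl; lra.
pose D := (140 * (d * h))%N; pose K := (k ^ D)%N.
have K0 : (0 < K)%N by rewrite expn_gt0 (ltnW k2).
have K_n : K%:R ^+ 20 <= #|G|%:R :> R.
  apply: le_trans nG; rewrite natrX -exprM -powR_mulrn ?(ltW k0) //.
  apply: ler_powR => //.
  have -> : (D * 20)%:R = 2800 * d%:R * h%:R :> R.
    by rewrite /D mulnAC mulnA !natrM.
  have -> : 2800 * 2 * d%:R * log2 chi%:R =
      2800 * d%:R * (2 * log2 chi%:R) :> R.
    by rewrite -!mulrA [2 * (d%:R * _)]mulrCA.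
  by rewrite ler_wpM2l // mulr_ge0 ?ler0n.
have n_ge1 : 1 <= #|G|%:R :> R.
  by apply: le_trans K_n; rewrite exprn_ege1 // ler1n.
have K_le_n : (K <= #|G|)%N.
  rewrite -(ler_nat R); apply: le_trans K_n.
  by rewrite exprS ler_peMr ?ler0n // exprn_ege1 // ler1n.
pose m := (#|G| %/ K)%N.
have m_gt0 : (0 < m)%N by rewrite divn_gt0.
pose lambda : R := #|G|%:R `^ (9 / 10).
have lambda_le : lambda <= k%:R^-1 ^+ 2 / 4 * m%:R.
  have K2 : K%:R ^+ 2 <= #|G|%:R `^ (1 / 10) :> R.
    have -> : K%:R ^+ 2 = (K%:R ^+ 20) `^ (1 / 10) :> R.
      rewrite -[20%N]/(2 * 10)%N exprM.
      rewrite -(@powR_mulrn _ (K%:R ^+ 2) 10) ?exprn_ge0 //.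
      rewrite -powRrM.
      have -> : 10%:R * (1 / 10) = 1 :> R by field.
      by rewrite powRr1 // exprn_ge0.
    by apply: ge0_ler_powR; rewrite ?nnegrE ?exprn_ge0 //; lra.
  have n_split : lambda * #|G|%:R `^ (1 / 10) = #|G|%:R.
    rewrite -powRD; last first.
      by apply/implyP => _; rewrite gt_eqF // (lt_le_trans ltr01).
    have -> : 9 / 10 + 1 / 10 = 1 :> R by field.
    by rewrite powRr1.
  have lK2 : lambda * K%:R ^+ 2 <= #|G|%:R.
    by rewrite -[leRHS]n_split ler_wpM2l // powR_ge0.
  have n_m : #|G|%:R <= 2 * m%:R * K%:R :> R.
    rewrite -!natrM ler_nat; apply: leq_trans (ltnW (ltn_ceil #|G| K0)) _.
    by rewrite leq_mul2r -/m mul2n -addnn -addn1 leq_add2l m_gt0 orbT.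
  have K0R : 0 < K%:R :> R by rewrite ltr0n.
  have lK : lambda * K%:R <= 2 * m%:R.
    by rewrite -(ler_pM2r K0R) -mulrA -expr2; exact: le_trans n_m.
  have K8 : 8 * k%:R ^+ 2 <= K%:R :> R.
    rewrite -natrX -natrM ler_nat; apply: (@leq_trans (k ^ 5)%N).
      rewrite -[5%N]/(3 + 2)%N expnD leq_mul2r -[8%N]/(2 ^ 3)%N leq_exp2r //.
      by rewrite k2 orbT.
    rewrite leq_exp2l //; move: (leq_mul d2 h_gt0); rewrite /D; clear; lia.
  have : lambda * (8 * k%:R ^+ 2) <= 2 * m%:R.
    by apply: le_trans lK; rewrite ler_wpM2l // powR_ge0.
  have -> : k%:R^-1 ^+ 2 / 4 * m%:R = 2 * m%:R / (8 * k%:R ^+ 2) :> R.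
    by field; rewrite gt_eqF.
  by rewrite ler_pdivlMr // mulr_gt0 ?exprn_gt0.
have eta_ge0 : 0 <= k%:R^-1 ^+ 2 / 4 :> R.
  by rewrite divr_ge0 // exprn_ge0 // invr_ge0.
have jum : jumbled (@edge G) (k%:R^-1 : R) (k%:R^-1 ^+ 2 / 4) m.
  rewrite div1r in prG.
  exact (pseudo_random_jumbled m_gt0 (powR_ge0 _ _) lambda_le prG).
have m_small : m%:R <= k%:R^-1 ^+ D * #|G|%:R :> R.
  rewrite exprVn -natrX mulrC ler_pdivlMr ?ltr0n // -natrM ler_nat.
  exact: leq_trunc_div.
move=> col; have [b copies] :=
  color_dichotomy k2 d2 h_gt0 h_le jum m_gt0 eta_ge0 (lexx _) m_small col.
exists b => H cardH degH chiH; apply: copies => //; apply: leq_trans q_le.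
by rewrite leq_min chiH -cardH chromatic_le_card.
Qed.
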